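(* Let the energy $E^{(k)}$ be the pair-interaction energy with potentials $W_{\rm NN}^{(k)},W_{\rm NNN}^{(k)}$ described in the context, satisfying (P1)--(P4), and assume in addition (P5) $\lim_{k\to\infty}k\bar W^{(k)}_{\rm NN}(r_k)=\omega_{\rm NN}$ and $\lim_{k\to\infty}k\bar W^{(k)}_{\rm NNN}(r_k)=\omega_{\rm NNN}$ for any sequence $r_k\to\infty$ (with constants $\omega_{\rm NN},\omega_{\rm NNN}$); (P6) $W_{\rm NN}^{(k)}$ and $W_{\rm NNN}^{(k)}$ are nondecreasing on $[1,\infty)$. Then $$0<\varphi(0,R)<\varphi(u,\tilde R)$$ for any $R,\tilde R\in{\rm SO}(3)$, $R\ne{\rm Id}$ and $0\ne u\in\mathbb R^3$, where $\varphi$ is the cell formula defined in the context.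
   Context: **Lattice.** $L>0$; $\emptyset\ne S\subset\mathbb R^2$ is a bounded domain, $S=\mathrm{Int}\bigcup_{x'\in\mathcal L'}(x'+[-\frac12,\frac12]^2)$ for a set $\mathcal L'\subset(\frac12+\mathbb Z)^2$; $\mathcal L:=\bar S\cap\mathbb Z^2$; whenever $x'+\{-\frac12,\frac12\}^2\subset\mathcal L$ then $x'\in\mathcal L'$. Set $\mathcal L^{\rm ext}=\mathcal L+\{-1,0,1\}^2$, $\mathcal L'^{,\rm ext}=\mathcal L'+\{-1,0,1\}^2$, $S^{\rm ext}=S+(-1,1)^2$, $L_k=\frac1k\lfloor kL\rfloor$, $\Lambda_k=([0,L]\times\frac1k\bar S)\cap\frac1k\mathbb Z^3$, $\hat\Lambda_k=k\Lambda_k$, $\hat\Lambda_k'=\{\frac12,\dots,kL_k-\frac12\}\times\mathcal L'$, $\hat\Lambda_k'^{,\rm surf}=\{\frac12,\dots,kL_k-\frac12\}\times(\mathcal L'^{,\rm ext}\setminus\mathcal L')$, $\hat\Lambda_k'^{,\rm end}=\{-\frac12,kL_k+\frac12\}\times\mathcal L'^{,\rm ext}$. Directions: $z^1=\frac12(-1,-1,-1)^\top$, $z^2=\frac12(-1,-1,1)^\top$, $z^3=\frac12(-1,1,1)^\top$, $z^4=\frac12(-1,1,-1)^\top$, and $z^{i+4}=z^i+e_1$ for $i=1,\dots,4$; $(z^i)'=(z^i_2,z^i_3)$. $\bar{\rm Id}=(z^1|\cdots|z^8)$, $\bar{\rm SO}(3)=\{R\,\bar{\rm Id}:R\in{\rm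 SO}(3)\}$, ${\rm O}(3)\bar{\rm Id}=\{Q\,\bar{\rm Id}:Q\in{\rm O}(3)\}$. For $\vec y=(\hat y_1|\cdots|\hat y_8)\in\mathbb R^{3\times8}$ put $\bar\nabla\hat y=\vec y-\frac18(\sum_j\hat y_j)(1,\dots,1)$. **Pair-interaction energy.** For $y\colon\Lambda_k\to\mathbb R^3$, $\hat y(\hat x)=ky(\frac1k\hat x)$, $$E^{(k)}(y)=\frac12\sum_{\hat x_*,\hat x_{**}\in\hat\Lambda_k,\,|\hat x_*-\hat x_{**}|=1}W_{\rm NN}^{(k)}(|\hat y(\hat x_* )-\hat y(\hat x_{**})|)+\frac12\sum_{\hat x_*,\hat x_{**}\in\hat\Lambda_k,\,|\hat x_*-\hat x_{**}|=\sqrt2}W_{\rm NNN}^{(k)}\Bigl(\frac{|\hat y(\hat x_* )-\hat y(\hat x_{**})|}{\sqrt2}\Bigr)+\mathcal X_k(y),$$ where $\mathcal X_k\ge0$ is a term included to guarantee preservation of orientation; it gives rise to the term $\chi^{(k)}$ below. With NN(N) meaning each of NN and NNN: (P1) $W_{\rm NN(N)}^{(k)}\colon[0,\infty)\to[0,\infty]$ is continuous and finite on $(0,\infty)$, and $W_{\rm NN(N)}^{(k)}(r)=0$ iff $r=1$. (P2) There are $c_{\rm f}^{(k)}\searrow0$ with $\lim_kk[c_{\rm f}^{(k)}]^2\in(0,\infty)$ such that $W_{\rm NN(N)}^{(k)}(r)=W_{\rm 0NN(N)}(r)$ for $r\in(1-c_{\rm f}^{(k)},1+c_{\rm f}^{(k)})$,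 where $W_{\rm 0NN(N)}$ is $C^2$ and $W_{\rm 0NN(N)}''(1)>0$. (P3) $W_{\rm NN(N)}^{(k)}(r)=\bar W_{\rm NN(N)}^{(k)}(r)$ if $r\in[0,1-c_{\rm f}^{(k)}]\cup[1+c_{\rm f}^{(k)},\infty)$, where $\bar W_{\rm NN(N)}^{(k)}$ is bounded below by $\bar c_{\rm NN(N)}^{(k)}$ with $k\bar c_{\rm NN(N)}^{(k)}\to\bar c_{\rm NN(N)}>0$; and $(k+1)W_{\rm NN(N)}^{(k+1)}\ge kW_{\rm NN(N)}^{(k)}$ for all $k$. (P4) $\bar W_{\rm NN(N)}^{(k)}(r)=\omega_{\rm NN(N)}^{(k)}+\frac1k\rho_{\rm NN(N)}(r)$ if $r\ge k\bar M_k$, for some $\bar M_k\to0$ with $k\bar M_k\to\infty$, where $\rho_{\rm NN(N)}(r)=O(r^{-1})$ as $r\to\infty$ and $\lim_kk\omega_{\rm NN(N)}^{(k)}\in(0,\infty)$. **Cell energies.** The energy is written as a sum of cell energies: with $\vec y(\hat x)=(\hat y(\hat x+z^1)|\cdots|\hat y(\hat x+z^8))$ (for $y$ extended to $\{-\frac1k,0,\dots,L_k+\frac1k\}\times\frac1k\mathcal L^{\rm ext}$), $$E^{(k)}(y)=\sum_{\hat x\in\hat\Lambda_k'}W^{(k)}_{\rm cell}(\vec y(\hat x))+\sum_{\hat x\in\hat\Lambda_k'^{,\rm surf}}W^{(k)}_{\rm surf}(\hat x',\vec y(\hat x))+\sum_{\hat x\in\hat\Lambda_k'^{,\rm end}}W^{(k)}_{\rm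 end}(\tfrac1k\hat x_1,\hat x',\vec y(\hat x)),$$ where, for $\vec y=(\hat y_1|\cdots|\hat y_8)\in\mathbb R^{3\times8}$ (sums over ordered pairs $(i,j)$), $$W^{(k)}_{\rm cell}(\vec y)=\frac18\sum_{|z^i-z^j|=1}W_{\rm NN}^{(k)}(|\hat y_i-\hat y_j|)+\frac14\sum_{|z^i-z^j|=\sqrt2}W_{\rm NNN}^{(k)}\Bigl(\frac{|\hat y_i-\hat y_j|}{\sqrt2}\Bigr)+\chi^{(k)}(\vec y),$$ and $W_{\rm surf}^{(k)}$, $W_{\rm end}^{(k)}$ are constructed in a similar manner to account for the surface contributions to atomic bonds lying on the rod's boundary. The frame-indifferent term $\chi^{(k)}$, $C/k\ge\chi^{(k)}\ge0$, penalizes deformations that are not locally orientation-preserving, i.e. it is greater than or equal to $\bar c/k$, $\bar c>0$, on a $k$-independent neighbourhood of ${\rm O}(3)\bar{\rm Id}\setminus\bar{\rm SO}(3)$ and vanishes otherwise. $W^{(k)}_{\rm tot}(x',\cdot)=W^{(k)}_{\rm cell}$ for $x'\in\mathcal L'$ and $=W^{(k)}_{\rm surf}(x',\cdot)$ for $x'\in\mathcal L'^{,\rm ext}\setminus\mathcal L'$. **Standing assumptions on the cell energies** ($\mathscr W^{(k)}$ stands for any of $W^{(k)}_{\rm cell}$, $W^{(k)}_{\rm surf}(\hat x',\cdot)$, $W^{(k)}_{\rm end}(\frac1k\hat x_1,\hat x',\cdot)$, all $[0,\infty]$-valued). (W1) $\mathscr W^{(k)}(R\vec y+(c|\cdots|c))=\mathscr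 W^{(k)}(\vec y)$ for $R\in{\rm SO}(3)$, $c\in\mathbb R^3$. (W2) $\mathscr W^{(k)}$ attains its minimum, equal to $0$, at $\vec y$ with $\hat y_i=Rz^i+c$, $R\in{\rm SO}(3)$, $c\in\mathbb R^3$. (W3) There are $c^{(k)}_{\rm frac}\searrow0$ with $\lim_kk(c^{(k)}_{\rm frac})^2\in(0,\infty)$ and $W_0\colon\mathcal L'^{,\rm ext}\times\mathbb R^{3\times8}\to[0,\infty]$ with $W^{(k)}_{\rm tot}(x',\vec y)=W_0(x',\vec y)$ whenever $\mathrm{dist}(\bar\nabla\hat y,\bar{\rm SO}(3))\le c^{(k)}_{\rm frac}$; and for such $\vec y$, $W_{\rm end}^{(k)}(\cdot,\cdot,\vec y)\le C\,\mathrm{dist}^2(\bar\nabla\hat y,\bar{\rm SO}(3))$ with $C$ independent of $k$. (W4) $W^{(k+1)}_{\rm tot}(x',\vec y)\ge\frac k{k+1}W^{(k)}_{\rm tot}(x',\vec y)$ for all $k,x',\vec y$. (W5) On $\mathcal L'$, $W_0$ does not depend on $x'$ and $W_0(\vec y)\ge c_{\rm W}\mathrm{dist}^2(\bar\nabla\hat y,\bar{\rm SO}(3))$ for all $\vec y$, with $c_{\rm W}>0$; and $W^{(k)}_{\rm cell}(\vec y)\ge\bar c_1^{(k)}$ whenever $\mathrm{dist}(\bar\nabla\hat y,\bar{\rm SO}(3))>c^{(k)}_{\rm frac}$, where $\bar c_1^{(k)}>0$ and $\lim_kk\bar c_1^{(k)}\in(0,\infty)$. (W6) $\mathscr W^{(k)}$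 is Borel, and $W_0(x',\cdot)$ is $C^2$ near $\bar{\rm SO}(3)$ for each $x'\in\mathcal L'^{,\rm ext}$. (W7) $W^{(k)}_{\rm surf}(\hat x',\vec y)$ may depend on $\hat y_i$ only if $\hat x'+(z^i)'\in\mathcal L$; $W_{\rm end}^{(k)}(x_1,\hat x',\vec y)$ may depend on $\hat y_i$ only if $(x_1+\frac1kz^i_1,\hat x'+(z^i)')\in\{0,\frac1k,\dots,L_k\}\times\mathcal L$. **Cell formula.** For $r>0$, $k\in\mathbb N$ put $h=\frac1{rk}$, $\Lambda_{r,k}=(h\mathbb Z\cap(-1-h,1+h))\times\mathcal L^{\rm ext}$, $\Lambda'_{r,k}=((\frac h2+h\mathbb Z)\cap(-1-\frac h2,1+\frac h2))\times\mathcal L'^{,\rm ext}$. ${\rm PAff}(\Lambda_{r,k})$ is the set of $\mathbb R^3$-valued piecewise affine maps obtained from arbitrary values on $\Lambda_{r,k}$ as follows: on each block $(w_1,x')+[-\frac h2,\frac h2]\times[-\frac12,\frac12]^2$ with corners in $\Lambda_{r,k}$ and $x'\in\mathcal L'^{,\rm ext}$, the value at the centre is the average of the 8 corner values, the value at the centre of each face is the average of its 4 corner values, and the map is affine on each of the 24 simplices spanned by the block centre, a face centre and two adjacent corners of that face. For $v\in{\rm PAff}(\Lambda_{r,k})$, $\vec v(w_1,x')=k\bigl(v(w_1+hz_1^i,x'+(z^i)')\bigr)_{i=1}^8$. Let $I^-=[-1,-\frac34]$, $I^+=[\frac34,1]$. For $y^\pm\in\mathbb R^3$, $R^\pm\in{\rm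 SO}(3)$ let $\mathcal V_{y^+-y^-,(R^-)^{-1}R^+}$ be the set of triples $((r_n)_n,(k_n)_n,(v_n)_n)$ with $r_n>0$, $k_n\in\mathbb N$, $v_n\in{\rm PAff}(\Lambda_{r_n,k_n})$, $r_n\searrow0$, $r_nk_n\to\infty$, and $v_n(w_1,x')=R_\pm^{n}(r_nw_1,\frac1{k_n}x')^\top+y_\pm^n$ on $I^\pm\times\overline{S^{\rm ext}}$ for some $R^n_\pm\in{\rm SO}(3)$, $y^n_\pm\in\mathbb R^3$ with $R_\pm^n\to R^\pm$, $y_\pm^n\to y^\pm$. The function $\varphi\colon\mathbb R^3\times{\rm SO}(3)\to[0,\infty]$ is given by $$\varphi\bigl(y^+-y^-,(R^-)^{-1}R^+\bigr)=\min\Bigl\{\limsup_{n\to\infty}\sum_{(w_1,x')\in\Lambda'_{r_n,k_n}}k_nW^{(k_n)}_{\rm tot}(x',\vec v_n(w_1,x'))\;:\;((r_n)_n,(k_n)_n,(v_n)_n)\in\mathcal V_{y^+-y^-,(R^-)^{-1}R^+}\Bigr\}.$$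
   Formalization: The neighbourhood of O(3)Id \ SO(3)Id on which the term χ is supported is required to contain only orientation-reversing cells (negative determinant of the discrete deformation gradient); for arbitrary large neighbourhoods the strict inequality φ(0,R) < φ(u,R̃) can fail. *)

(* Defs.v *)
From HB Require Import structures.
From mathcomp Require Import all_boot all_order all_algebra.
From mathcomp Require Import all_classical all_reals all_analysis.

Set Implicit Arguments.
Unset Strict Implicit.
Unset Printing Implicit Defensive.

Import Order.TTheory GRing.Theory Num.Theory.
Import numFieldNormedType.Exports.

Local Open Scope classical_set_scope.
Local Open Scope ring_scope.

(* Sequences of the model are indexed by k >= 1: their value at k = 0 is never
   constrained. *)

Definition borel (T : topologicalType) : set (set T) :=
  <<s [set A : set T | open A] >>.

Section Matrices.
Context {R : realType}.

(* The canonical norm on matrices in the library is the sup norm, hence an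
   explicit Euclidean (Frobenius) norm. *)
Definition enorm m n (A : 'M[R]_(m, n)) : R :=
  Num.sqrt (\sum_i \sum_j A i j ^+ 2).

Definition O3 : set 'M[R]_3 := [set Q | Q *m Q^T = 1%:M].
Definition SO3 : set 'M[R]_3 := [set Q | O3 Q /\ \det Q = 1].

(* The columns are z^1, ..., z^8. *)
Definition Idbar : 'M[R]_(3, 8) :=
  2^-1 *: \matrix_(j, i)
    (nth 0 (nth [::]
       [:: [:: -1; -1; -1; -1;  1;  1;  1;  1];
           [:: -1; -1;  1;  1; -1; -1;  1;  1];
           [:: -1;  1;  1; -1; -1;  1;  1; -1]] j) i : int)%:~R.

Definition zdir (i : 'I_8) : 'cV[R]_3 := col i Idbar.
Definition z1 (i : 'I_8) : R := Idbar ord0 i.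
Definition z' (i : 'I_8) : R * R := (Idbar (inord 1) i, Idbar (inord 2) i).

Definition SO3bar : set 'M[R]_(3, 8) := [set Q *m Idbar | Q in SO3].
Definition O3bar : set 'M[R]_(3, 8) := [set Q *m Idbar | Q in O3].

Definition gradbar (y : 'M[R]_(3, 8)) : 'M[R]_(3, 8) :=
  y - 8^-1 *: ((\sum_j col j y) *m const_mx 1).

Definition edist (A : 'M[R]_(3, 8)) (E : set 'M[R]_(3, 8)) : R :=
  inf [set enorm (A - B) | B in E].

(* (c|...|c) *)
Definition translation (c : 'cV[R]_3) : 'M[R]_(3, 8) := c *m const_mx 1.

Definition C2_on (V : normedModType R) (U : set V) (f : V -> R) : Prop :=
  forall x, U x -> forall a b : V,
    [/\ derivable f x a, derivable ('D_a f) x b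
      & {for x, continuous ('D_b ('D_a f))}].

End Matrices.

Section Lattice.
Context {R : realType}.
Variable cells : set (R * R). (* the set L' of midpoints of unit squares *)

Definition half_integers : set (R * R) :=
  [set x | x.1 - 2^-1 \is a Num.int /\ x.2 - 2^-1 \is a Num.int].

Definition section_dom : set (R * R) :=
  interior [set x | exists2 x', cells x' &
    `|x.1 - x'.1| <= 2^-1 /\ `|x.2 - x'.2| <= 2^-1].

Definition atoms : set (R * R) :=
  [set x | closure section_dom x /\ (x.1 \is a Num.int /\ x.2 \is a Num.int)].

(* A + {-1,0,1}^2 *)
Definition lattice_ext (A : set (R * R)) : set (R * R) :=
  [set x | exists2 a, A a & exists i j : int,
    [/\ `|i| <= 1, `|j| <= 1 & x = a + (i%:~R, j%:~R)]].

Definition section_ext : set (R * R) :=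
  [set x | exists2 s, section_dom s & `|x.1 - s.1| < 1 /\ `|x.2 - s.2| < 1].

Record cross_section : Prop := CrossSection {
  cells_half_integer : cells `<=` half_integers;
  section_nonempty : section_dom !=set0;
  section_bounded : bounded_set section_dom;
  section_connected : connected section_dom;
  cells_full : forall x' : R * R,
    (forall i : 'I_8, atoms (x' + z' i)) -> cells x' }.

End Lattice.

Section PairPotentials.
Context {R : realType}.

(* W k and Wb k are only used on [0, +oo[.  The sequences cf and Mb are common
   to both potentials. *)
Record pair_potential (cf Mb : nat -> R) (W Wb : nat -> R -> \bar R)
    (W0 : R -> R) : Prop := PairPotential {
  potential_ge0 : forall k (r : R), (0 < k)%N -> 0 <= r -> (0 <= W k r)%E;
  potential_continuous : forall k (r : R), (0 < k)%N -> 0 < r ->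
    {for r, continuous (W k)} /\ W k r \is a fin_num;
  potential_eq0 : forall k (r : R), (0 < k)%N -> 0 <= r ->
    (W k r = 0%E <-> r = 1);
  elastic_range : forall k (r : R), (0 < k)%N -> 0 <= r ->
    1 - cf k < r < 1 + cf k -> W k r = (W0 r)%:E;
  elastic_C2 : C2_on [set r : R | 0 < r] W0;
  elastic_convex : 0 < derive1n 2 W0 1;
  fracture_ge0 : forall k (r : R), (0 < k)%N -> 0 <= r -> (0 <= Wb k r)%E;
  fracture_range : forall k (r : R), (0 < k)%N -> 0 <= r ->
    r <= 1 - cf k \/ 1 + cf k <= r -> W k r = Wb k r;
  fracture_bound : exists2 cb : nat -> R,
    (forall k (r : R), (0 < k)%N -> 0 <= r -> ((cb k)%:E <= Wb k r)%E) &
    (exists2 c : R, 0 < c & (fun k => k%:R * cb k) @ \oo --> c);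
  potential_monotone : forall k (r : R), (0 < k)%N -> 0 <= r ->
    (k%:R%:E * W k r <= k.+1%:R%:E * W k.+1 r)%E;
  long_range : exists omega : nat -> R, exists rho : R -> R,
    [/\ forall k (r : R), (0 < k)%N -> 0 <= r -> k%:R * Mb k <= r ->
          Wb k r = (omega k + k%:R^-1 * rho r)%:E,
        exists C : R, \forall r \near +oo, `|rho r| <= C / r
      & exists2 w : R, 0 < w & (fun k => k%:R * omega k) @ \oo --> w] }.

(* c^(k) decreases to 0 and k (c^(k))^2 converges in ]0, +oo[ *)
Definition frac_threshold (c : nat -> R) : Prop :=
  [/\ forall k, (0 < k)%N -> 0 < c k,
      forall k, (0 < k)%N -> c k.+1 <= c k,
      c @ \oo --> (0 : R)
    & exists2 l : R, 0 < l & (fun k => k%:R * c k ^+ 2) @ \oo --> l].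

Definition long_range_threshold (Mb : nat -> R) : Prop :=
  Mb @ \oo --> (0 : R) /\ (fun k => k%:R * Mb k) @ \oo --> +oo.

Definition fracture_limit (Wb : nat -> R -> \bar R) (omega : R) : Prop :=
  forall r : nat -> R, r @ \oo --> +oo ->
    (fun k => k%:R%:E * Wb k (r k))%E @ \oo --> omega%:E.

Definition nondecreasing_from1 (W : nat -> R -> \bar R) : Prop :=
  forall k (r s : R), (0 < k)%N -> 1 <= r -> r <= s -> (W k r <= W k s)%E.

End PairPotentials.

Section CellEnergies.
Context {R : realType}.
Variable L : R.
Variable cells : set (R * R).
Variables WNN WNNN : nat -> R -> \bar R.
Variable chi : nat -> 'M[R]_(3, 8) -> R.

Definition at_distance (l : R) (i j : 'I_8) : bool :=
  enorm (zdir i - zdir j) == l.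

(* Bonds of a unit cell having both ends in P.  The weights are those of
   W_cell: in the full lattice a nearest-neighbour bond belongs to 4 cells and
   a next-to-nearest-neighbour bond to 2, and each bond is counted twice in a
   sum over ordered pairs.  With P selecting the corners that are atoms of the
   rod, the sum over all bulk, surface and end cells is thus the sum over all
   the bonds of the rod. *)
Definition bond_energy (P : pred 'I_8) (k : nat) (y : 'M[R]_(3, 8)) : \bar R :=
  ((8^-1)%:E * (\sum_(i | P i)
      \sum_(j | P j && at_distance 1 i j)
        WNN k (enorm (col i y - col j y))) +
   (4^-1)%:E * (\sum_(i | P i)
      \sum_(j | P j && at_distance (Num.sqrt 2) i j)
        WNNN k (enorm (col i y - col j y) / Num.sqrt 2)))%E.

Definition Wcell (k : nat) (y : 'M[R]_(3, 8)) : \bar R :=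
  (bond_energy predT k y + (chi k y)%:E)%E.

Definition surf_corner (x' : R * R) : pred 'I_8 :=
  fun i => (x' + z' i) \in atoms cells.

Definition Wsurf (k : nat) (x' : R * R) (y : 'M[R]_(3, 8)) : \bar R :=
  bond_energy (surf_corner x') k y.

(* L_k *)
Definition rod_length (k : nat) : R :=
  (Num.floor (k%:R * L))%:~R / k%:R.

Definition end_corner (k : nat) (x1 : R) (x' : R * R) : pred 'I_8 :=
  fun i => ((x1 + z1 i / k%:R) \in
      [set t : R | exists2 n : nat, t = n%:R / k%:R & t <= rod_length k])
    && ((x' + z' i) \in atoms cells).

Definition Wend (k : nat) (x1 : R) (x' : R * R) (y : 'M[R]_(3, 8)) : \bar R :=
  bond_energy (end_corner k x1 x') k y.

Definition Wtot (k : nat) (x' : R * R) (y : 'M[R]_(3, 8)) : \bar R :=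
  if x' \in cells then Wcell k y else Wsurf k x' y.

(* y *m Idbar^T is twice the least-squares linear map fitting
   z^i |-> y_i - (mean of the y_j), i.e. twice the discrete deformation gradient
   of the cell.  Its determinant is negative on O3bar `\` SO3bar, hence on every
   sufficiently small neighbourhood of this set: [orientation_reversing] only
   excludes neighbourhoods so large that chi would penalize cells that do not
   reverse orientation. *)
Definition orientation_reversing : set 'M[R]_(3, 8) :=
  [set y | \det (y *m Idbar^T) < 0].

Record orientation_penalty : Prop := OrientationPenalty {
  penalty_frame_indifferent : forall k Q c y, (0 < k)%N -> SO3 Q ->
    chi k (Q *m y + translation c) = chi k y;
  penalty_bounds : exists2 C : R, 0 < C &
    forall k y, (0 < k)%N -> 0 <= chi k y <= C / k%:R;
  penalty_support : exists U : set 'M[R]_(3, 8),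
    [/\ forall y, (O3bar `\` SO3bar) y -> nbhs y U,
        U `<=` orientation_reversing,
        exists2 c : R, 0 < c &
          forall k y, (0 < k)%N -> U y -> c / k%:R <= chi k y
      & forall k y, (0 < k)%N -> ~ U y -> chi k y = 0] }.

Definition end_slices (k : nat) : set R :=
  [set - (2^-1 / k%:R); rod_length k + 2^-1 / k%:R].

(* Any of the energies W_cell^(k), W_surf^(k)(x', .), W_end^(k)(x1, x', .) *)
Definition is_cell_energy (k : nat) (W : 'M[R]_(3, 8) -> \bar R) : Prop :=
  [\/ W = Wcell k,
      exists2 x', (lattice_ext cells `\` cells) x' & W = Wsurf k x'
    | exists x1 x', [/\ end_slices k x1, lattice_ext cells x'
                      & W = Wend k x1 x']].

Record standing_assumptions_for (cfrac : nat -> R)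
    (W0 : R * R -> 'M[R]_(3, 8) -> \bar R) : Prop := StandingAssumptions {
  W_frame_indifferent : forall k W Q c y, (0 < k)%N -> is_cell_energy k W ->
    SO3 Q -> W (Q *m y + translation c) = W y;
  W_ge0 : forall k W y, (0 < k)%N -> is_cell_energy k W -> (0 <= W y)%E;
  W_min : forall k W Q c, (0 < k)%N -> is_cell_energy k W -> SO3 Q ->
    W (Q *m Idbar + translation c) = 0%E;
  W_threshold : frac_threshold cfrac;
  W0_ge0 : forall x' y, lattice_ext cells x' -> (0 <= W0 x' y)%E;
  W_elastic : forall k x' y, (0 < k)%N -> lattice_ext cells x' ->
    edist (gradbar y) SO3bar <= cfrac k -> Wtot k x' y = W0 x' y;
  W_end_bound : exists C : R, forall k x1 x' y, (0 < k)%N ->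
    end_slices k x1 -> lattice_ext cells x' ->
    edist (gradbar y) SO3bar <= cfrac k ->
    (Wend k x1 x' y <= (C * edist (gradbar y) SO3bar ^+ 2)%:E)%E;
  W_monotone : forall k x' y, (0 < k)%N -> lattice_ext cells x' ->
    ((k%:R / k.+1%:R)%:E * Wtot k x' y <= Wtot k.+1 x' y)%E;
  W0_uniform : forall x' x'' y, cells x' -> cells x'' -> W0 x' y = W0 x'' y;
  W0_coercive : exists2 c : R, 0 < c & forall x' y, cells x' ->
    ((c * edist (gradbar y) SO3bar ^+ 2)%:E <= W0 x' y)%E;
  W_fracture : exists2 c1 : nat -> R,
    (forall k, (0 < k)%N -> 0 < c1 k /\
      forall y, cfrac k < edist (gradbar y) SO3bar ->
        ((c1 k)%:E <= Wcell k y)%E) &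
    (exists2 l : R, 0 < l & (fun k => k%:R * c1 k) @ \oo --> l);
  W_borel : forall k W, (0 < k)%N -> is_cell_energy k W ->
    forall B : set (\bar R), borel B -> borel (W @^-1` B);
  W0_C2 : forall x', lattice_ext cells x' ->
    exists U : set 'M[R]_(3, 8),
      [/\ open U, SO3bar `<=` U, forall y, U y -> W0 x' y \is a fin_num
        & C2_on U (fun y => fine (W0 x' y))];
  W_surf_local : forall k x' y1 y2, (0 < k)%N ->
    (lattice_ext cells `\` cells) x' ->
    (forall i, surf_corner x' i -> col i y1 = col i y2) ->
    Wsurf k x' y1 = Wsurf k x' y2;
  W_end_local : forall k x1 x' y1 y2, (0 < k)%N ->
    end_slices k x1 -> lattice_ext cells x' ->
    (forall i, end_corner k x1 x' i -> col i y1 = col i y2) ->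
    Wend k x1 x' y1 = Wend k x1 x' y2 }.

Definition standing_assumptions : Prop :=
  exists cfrac W0, standing_assumptions_for cfrac W0.

End CellEnergies.

Section CellFormula.
Context {R : realType}.
Variable cells : set (R * R).

Definition mesh (r : R) (k : nat) : R := (r * k%:R)^-1.

Definition Lam (r : R) (k : nat) : set (R * (R * R)) :=
  [set w | [/\ w.1 / mesh r k \is a Num.int,
               -1 - mesh r k < w.1 < 1 + mesh r k
             & lattice_ext (atoms cells) w.2]].

Definition Lam' (r : R) (k : nat) : set (R * (R * R)) :=
  [set w | [/\ w.1 / mesh r k - 2^-1 \is a Num.int,
               -1 - mesh r k / 2 < w.1 < 1 + mesh r k / 2
             & lattice_ext cells w.2]].

Definition corner (h : R) (w : R * (R * R)) (i : 'I_8) : R * (R * R) :=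
  w + (h * z1 i, z' i).

(* The face of the block orthogonal to the j-th direction that contains the
   i-th corner *)
Definition same_face (j : 'I_3) (i l : 'I_8) : bool :=
  Idbar j l == Idbar j i :> R.

Definition face_center (h : R) (w : R * (R * R)) (j : 'I_3) (i : 'I_8) :
    R * (R * R) :=
  4^-1 *: \sum_(l | same_face j i l) corner h w l.

(* Membership in PAff(Lam r k); v is only relevant on the union of the blocks. *)
Definition PAff (r : R) (k : nat) (v : R * (R * R) -> 'cV[R]_3) : Prop :=
  let h := mesh r k in
  forall w, lattice_ext cells w.2 -> (forall i, Lam r k (corner h w i)) ->
    [/\ v w = 8^-1 *: \sum_i v (corner h w i),
        forall j i, v (face_center h w j i) =
          4^-1 *: \sum_(l | same_face j i l) v (corner h w l)
      & forall j i l, same_face j i l ->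
          at_distance (1 : R) i l ->
          forall a b c d : R, 0 <= a -> 0 <= b -> 0 <= c -> 0 <= d ->
            a + b + c + d = 1 ->
            v (a *: w + b *: face_center h w j i
               + c *: corner h w i + d *: corner h w l) =
            a *: v w + b *: v (face_center h w j i)
               + c *: v (corner h w i) + d *: v (corner h w l)].

Definition cell_values (r : R) (k : nat) (v : R * (R * R) -> 'cV[R]_3)
    (w : R * (R * R)) : 'M[R]_(3, 8) :=
  \matrix_(j, i) (k%:R * v (corner (mesh r k) w i) j ord0).

Definition vec3 (a b c : R) : 'cV[R]_3 := \col_j nth 0 [:: a; b; c] j.

Definition rigid_on (I : set R) (r : R) (k : nat) (Q : 'M[R]_3) (y : 'cV[R]_3)
    (v : R * (R * R) -> 'cV[R]_3) : Prop :=
  forall w1 x', I w1 -> closure (section_ext cells) x' ->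
    v (w1, x') = Q *m vec3 (r * w1) (x'.1 / k%:R) (x'.2 / k%:R) + y.

(* V_{u,Q}: the triples admissible for some y^-, y^+, R^-, R^+ with
   y^+ - y^- = u and (R^-)^-1 R^+ = Q. *)
Definition admissible (u : 'cV[R]_3) (Q : 'M[R]_3) (r : nat -> R)
    (k : nat -> nat) (v : nat -> R * (R * R) -> 'cV[R]_3) : Prop :=
  [/\ forall n, [/\ 0 < r n, (0 < k n)%N & PAff (r n) (k n) (v n)],
      (forall n, r n.+1 <= r n) /\ r @ \oo --> (0 : R),
      (fun n => r n * (k n)%:R) @ \oo --> +oo
    & exists ym yp : 'cV[R]_3, exists Rm Rp : 'M[R]_3,
      [/\ SO3 Rm /\ SO3 Rp, yp - ym = u, invmx Rm *m Rp = Q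
        & exists ymn ypn : nat -> 'cV[R]_3, exists Rmn Rpn : nat -> 'M[R]_3,
          [/\ forall n,
                [/\ SO3 (Rmn n), SO3 (Rpn n),
                    rigid_on `[-1, - (3 / 4)] (r n) (k n) (Rmn n) (ymn n) (v n)
                  & rigid_on `[3 / 4, 1] (r n) (k n) (Rpn n) (ypn n) (v n)],
              ymn @ \oo --> ym, ypn @ \oo --> yp,
              Rmn @ \oo --> Rm & Rpn @ \oo --> Rp]]].

Definition cell_formula (W : nat -> R * R -> 'M[R]_(3, 8) -> \bar R)
    (u : 'cV[R]_3) (Q : 'M[R]_3) : \bar R :=
  ereal_inf [set e | exists r k v, admissible u Q r k v /\
    e = limn_esup (fun n => \sum_(w \in Lam' (r n) (k n))
          ((k n)%:R%:E * W (k n) w.2 (cell_values (r n) (k n) (v n) w)))%E].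

End CellFormula.

(* Main.v *)
Require Import Defs.
From mathcomp Require Import all_boot all_order all_algebra.
From mathcomp Require Import all_classical all_reals all_analysis.
From mathcomp Require Import ring lra zify.
Import Order.TTheory GRing.Theory Num.Theory.
Import numFieldNormedType.Exports.
Local Open Scope classical_set_scope.
Local Open Scope ring_scope.

(** Along a column of cells the lateral edge vectors of the slices have to turn
from their values on the left to those on the right. If no cell of the column
is broken, then the elastic energies needed for this add up, by Cauchy-Schwarz,
to at least [c / r], which tends to infinity; a single broken cell costs at
least [c1 k], and [k * c1 k] has a positive limit. Hence [phi 0 Q > 0] for
[Q <> 1].

A jump [u <> 0] tears all bonds apart: the bonds between neighbouring slices
can be arranged in zigzag paths through the rod, each of which contains one bond
whose length tends to infinity, so that [phi u Qt] is at least the sum of the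
limit energies of all the bonds crossing a section. For [u = 0] the rod can be
broken between two flat slices and the right-hand part, rotated by [Q], moved
back until some bond reaches its rest length. By monotonicity every crossing
bond then costs at most its limit energy, and the bond of rest length costs
nothing. *)

Set Implicit Arguments.
Unset Strict Implicit.
Unset Printing Implicit Defensive.

(** The upper bound must not activate the orientation penalty: bringing the two crack surfaces into
    contact could reverse the orientation of a bulk cell. The determinant that detects this is
    affine in the shift of the right-hand part. The shift therefore starts where the atom that is
    lowest along the gradient of this determinant coincides with its partner across the crack, and
    moves in a direction in which no determinant decreases. It stops at the last moment at which
    some crossing bond has its rest length, so that no other crossing bond is compressed; this
    matters because the potentials are monotone only on [[1, +oo[]. Such a shift is of atomic size
    and disappears after division by [k], which gives [u = 0].

    In the lower bound for a jump the long bonds of different paths may lie in different layers, so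
    the energy is counted along paths and not in a single section. Strictness comes from a fixed
    gap: the bond in contact saves its positive limit energy, whereas the lower bound loses an
    arbitrarily small amount on each of finitely many bonds. *)

(** * Combinatorics and geometry of the corners of a cell *)

(** Corners as vertices of the cube [{0,1}^3], with [z^i = zbit - 1/2]. The last bit is an exclusive
    or because the corners are numbered cyclically around each face orthogonal to the axis. *)
Definition zbit (j : 'I_3) (i : 'I_8) : bool :=
  nth false [:: 4 <= i; odd i./2; odd i./2 (+) odd i]%N j.

Definition flip (i : 'I_8) : 'I_8 :=
  inord (if (i < 4)%N then i + 4 else i - 4)%N.

(** The Hamming distance, which on a unit cube is the squared Euclidean distance: 1 for nearest and
    2 for next-to-nearest neighbours. *)
Definition ndiff (i j : 'I_8) : nat := \sum_c (zbit c i != zbit c j).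

Lemma zbit_flip (j : 'I_3) i : zbit j (flip i) = (j == ord0) (+) zbit j i.
Proof.
rewrite /zbit /flip inordK; last by case: i => -[|[|[|[|[|[|[|[|//]]]]]]]].
by case: j => -[|[|[|//]]] ?; case: i => -[|[|[|[|[|[|[|[|//]]]]]]]] ?.
Qed.

Lemma flipK : involutive flip.
Proof.
have lt8 (i : 'I_8) : ((if (i < 4)%N then i + 4 else i - 4) < 8)%N.
  by case: i => -[|[|[|[|[|[|[|[|//]]]]]]]].
move=> i; apply: val_inj; rewrite /= {1}/flip inordK ?lt8 // /flip inordK ?lt8 //.
by case: i => -[|[|[|[|[|[|[|[|//]]]]]]]].
Qed.

Lemma ndiff_flip i j : ndiff (flip j) (flip i) = ndiff i j.
Proof.
apply: eq_bigr => c _; rewrite !zbit_flip eq_sym.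
by case: (c == _); case: (zbit c i); case: (zbit c j).
Qed.

Lemma ndiff_le3 i j : (ndiff i j <= 3)%N.
Proof. by rewrite /ndiff !big_ord_recl big_ord0; do !case: eqP. Qed.

Section Cell.
Context {R : realType}.
Implicit Types (i j : 'I_8) (c : 'I_3).

Lemma IdbarE c i : Idbar c i = (zbit c i)%:R - 2^-1 :> R.
Proof.
rewrite /Idbar !mxE /zbit.
by case: c => -[|[|[|//]]] ?; case: i => -[|[|[|[|[|[|[|[|//]]]]]]]] ?;
  rewrite /= ?mulr1z ?mulrN1z; lra.
Qed.

Lemma z1E i : z1 i = (zbit ord0 i)%:R - 2^-1 :> R.
Proof. by rewrite /z1 IdbarE. Qed.

Lemma z'E i : z' i =
  ((zbit (inord 1) i)%:R - 2^-1, (zbit (inord 2) i)%:R - 2^-1) :> R * R.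
Proof. by rewrite /z' !IdbarE. Qed.

Lemma z'_flip i : z' (flip i) = z' i :> R * R.
Proof.
rewrite !z'E !zbit_flip.
by rewrite -!val_eqE /= !inordK.
Qed.

Lemma enorm_ge0 m n (A : 'M[R]_(m, n)) : 0 <= enorm A.
Proof. exact: sqrtr_ge0. Qed.

Lemma enorm_entry m n (A : 'M[R]_(m, n)) a b : `|A a b| <= enorm A.
Proof.
rewrite /enorm -(@sqrtr_sqr _ (A a b)) ler_wsqrtr //.
rewrite (bigD1 a) //= (bigD1 b) //= -addrA lerDl addr_ge0 ?sumr_ge0 //.
- by move=> ? _; apply: sqr_ge0.
- by move=> ? _; apply: sumr_ge0 => ? _; apply: sqr_ge0.
Qed.

Lemma enorm_col (x : 'cV[R]_3) : enorm x = Num.sqrt (\sum_c x c ord0 ^+ 2).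
Proof. by congr Num.sqrt; apply: eq_bigr => c _; rewrite big_ord1. Qed.

Lemma enormN m n (A : 'M[R]_(m, n)) : enorm (- A) = enorm A.
Proof.
by congr Num.sqrt; do 2 (apply: eq_bigr => ? _); rewrite mxE sqrrN.
Qed.

Lemma enorm_zdir i j : enorm (zdir i - zdir j) = Num.sqrt (ndiff i j)%:R :> R.
Proof.
rewrite enorm_col; congr Num.sqrt; rewrite natr_sum; apply: eq_bigr => c _.
rewrite !(mxE, IdbarE).
by case: (zbit c i); case: (zbit c j) => /=; lra.
Qed.

Lemma at_distanceE (n : nat) i j :
  at_distance (Num.sqrt n%:R : R) i j = (ndiff i j == n).
Proof.
rewrite /at_distance enorm_zdir; apply/eqP/eqP => [/(congr1 (@GRing.exp R ^~ 2))|->//].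
by rewrite !sqr_sqrtr ?ler0n // => /eqP; rewrite eqr_nat => /eqP.
Qed.

Lemma at_distance1E i j : at_distance (1 : R) i j = (ndiff i j == 1)%N.
Proof. by rewrite -at_distanceE sqrtr1. Qed.

End Cell.

(** * Limits of the scaled pair potentials *)

Section Potential.
Context {R : realType}.
Variables (cf Mb : nat -> R) (W Wb : nat -> R -> \bar R) (W0 : R -> R) (om : R).
Hypothesis cfP : frac_threshold cf.
Hypothesis WP : pair_potential cf Mb W Wb W0.
Hypothesis WlimP : fracture_limit Wb om.
Hypothesis WndP : nondecreasing_from1 W.

Lemma scaled_potential_le k l r s : (0 < k)%N -> (k <= l)%N -> 1 <= r -> r <= s ->
  (k%:R%:E * W k r <= l%:R%:E * W l s)%E.
Proof.
move=> k0 kl r1 rs.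
apply: (@le_trans _ _ (k%:R%:E * W k s)%E).
  by rewrite lee_pmul2l ?lte_fin ?ltr0n // WndP.
rewrite -(subnK kl); elim: (l - k)%N => // n IH; apply: (le_trans IH).
rewrite addSn; apply: (potential_monotone WP); first by rewrite addn_gt0 k0 orbT.
by rewrite (le_trans ler01) // (le_trans r1).
Qed.

Lemma scaled_potential_diag : (fun k => (k%:R%:E * W k k%:R)%E) @ \oo --> om%:E.
Proof.
have /WlimP : (fun k : nat => k%:R) @ \oo --> (+oo : set_system R) by exact: cvgr_idn.
apply: cvg_trans; apply: near_eq_cvg.
have [_ _ cf0 _] := cfP.
have /cvgrPdist_lt /(_ 1 ltr01) cf1 := cf0.
near=> k; rewrite (fracture_range WP) //.
- by near: k; exists 1%N => //.
- right; have : `|0 - cf k| < 1 by near: k.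
  rewrite sub0r normrN => /ltr_normlW cfk1.
  have : (2 : R) <= k%:R by near: k; exists 2%N => //= n /=; rewrite ler_nat.
  lra.
Unshelve. all: by end_near. Qed.

(** By monotonicity in both [k] and [r], every scaled energy is dominated by the diagonal values
    [n W^(n)(n)] with large [n], and these tend to [om]. *)
Lemma scaled_potential_le_limit k r : (0 < k)%N -> 1 <= r ->
  (k%:R%:E * W k r <= om%:E)%E.
Proof.
move=> k0 r1; have := scaled_potential_diag => /cvg_lim <- //.
apply: lime_ge; first by apply/cvg_ex; exists om%:E; exact: scaled_potential_diag.
near=> n; apply: scaled_potential_le => //; near: n.
  by exists k.
exact: (nbhs_infty_ger r).
Unshelve. all: by end_near. Qed.

(** A single diagonal value within [eps] of the limit bounds all energies with larger [k] and [r]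
    from below, hence one threshold for both. *)
Lemma scaled_potential_ge eps : 0 < eps -> exists N : nat, forall k r,
  (N <= k)%N -> N%:R <= r -> ((om - eps)%:E <= k%:R%:E * W k r)%E.
Proof.
move=> e0; have : \forall k \near \oo, ((om - eps)%:E < k%:R%:E * W k k%:R)%E.
  have /(_ [set x | ((om - eps)%:E < x)%E]) := scaled_potential_diag.
  apply; apply: open_ereal_gt'.
  by rewrite lte_fin ltrBlDr ltrDl.
case=> N _ NP; exists N.+1 => k r Nk Nr.
apply: (@le_trans _ _ (N.+1%:R%:E * W N.+1 N.+1%:R)%E).
  by apply: ltW; apply: NP => /=.
by apply: scaled_potential_le => //; rewrite ler1n.
Qed.

Lemma fracture_limit_gt0 : 0 < om.
Proof.
have [cb cbW [c c0 cbc]] := fracture_bound WP.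
apply: (lt_le_trans c0); rewrite -lee_fin.
have /WlimP Wk : (fun k : nat => k%:R) @ \oo --> (+oo : set_system R) by exact: cvgr_idn.
have cbc' : (fun k => (k%:R * cb k)%:E) @ \oo --> c%:E.
  by apply: cvg_EFin => //; near=> k.
rewrite -(cvg_lim _ Wk) // -(cvg_lim _ cbc') //; apply: lee_lim.
- by apply/cvg_ex; exists c%:E.
- by apply/cvg_ex; exists om%:E.
near=> k; rewrite EFinM lee_wpmul2l ?lee_fin ?ler0n //; apply: cbW => //.
by near: k; exists 1%N.
Unshelve. all: by end_near. Qed.

Lemma potential_rest k : (0 < k)%N -> W k 1 = 0%E.
Proof. by move=> k0; apply/(potential_eq0 WP). Qed.

End Potential.

(** * Energies of single bonds *)

Section Bond.
Context {R : realType}.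
Variables (WNN WNNN : nat -> R -> \bar R) (omegaNN omegaNNN : R).
Implicit Types (i j : 'I_8) (k : nat).

(** Carries the weight of the bond within one cell. The length [l] is not normalized, so the rest
    length is the square root of [ndiff i j]; space diagonals carry no energy. *)
Definition bond k i j (l : R) : \bar R :=
  if (ndiff i j == 1)%N then ((8^-1)%:E * WNN k l)%E
  else if (ndiff i j == 2)%N then ((4^-1)%:E * WNNN k (l / Num.sqrt 2))%E else 0%E.

Definition bond_limit i j : R :=
  if (ndiff i j == 1)%N then 8^-1 * omegaNN
  else if (ndiff i j == 2)%N then 4^-1 * omegaNNN else 0.

Lemma bond_flip k i j : bond k (flip j) (flip i) = bond k i j.
Proof. by rewrite /bond ndiff_flip. Qed.

Variables (cf Mb : nat -> R) (WbNN WbNNN : nat -> R -> \bar R) (W0NN W0NNN : R -> R).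
Hypothesis cfP : frac_threshold cf.
Hypothesis NNP : pair_potential cf Mb WNN WbNN W0NN.
Hypothesis NNNP : pair_potential cf Mb WNNN WbNNN W0NNN.

Lemma bond_ge0 k i j l : (0 < k)%N -> 0 <= l -> (0 <= bond k i j l)%E.
Proof.
move=> k0 l0; rewrite /bond; case: ifP => _; [|case: ifP => _ //].
  by rewrite mule_ge0 ?lee_fin // (potential_ge0 NNP).
by rewrite mule_ge0 ?lee_fin // (potential_ge0 NNNP) ?divr_ge0 ?sqrtr_ge0.
Qed.

Lemma bond_energyE (P : pred 'I_8) k (y : 'M[R]_(3, 8)) : (0 < k)%N ->
  bond_energy WNN WNNN P k y =
  (\sum_(i | P i) \sum_(j | P j) bond k i j (enorm (col i y - col j y)))%E.
Proof.
move=> k0; rewrite /bond_energy.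
have sge0 (l : R) i : (0 <= \sum_(j | P j && at_distance l i j)
    WNN k (enorm (col i y - col j y)))%E.
  by apply: sume_ge0 => j _; rewrite (potential_ge0 NNP) ?enorm_ge0.
have sge0' (l : R) i : (0 <= \sum_(j | P j && at_distance l i j)
    WNNN k (enorm (col i y - col j y) / Num.sqrt 2))%E.
  by apply: sume_ge0 => j _;
    rewrite (potential_ge0 NNNP) ?divr_ge0 ?enorm_ge0 ?sqrtr_ge0.
rewrite !ge0_sume_distrr // -big_split /=; apply: eq_bigr => i _.
rewrite !ge0_sume_distrr; last 2 first.
- by move=> j _; rewrite (potential_ge0 NNNP) ?divr_ge0 ?enorm_ge0 ?sqrtr_ge0.
- by move=> j _; rewrite (potential_ge0 NNP) ?enorm_ge0.
rewrite big_mkcondr [X in (_ + X)%E]big_mkcondr -big_split /=.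
apply: eq_bigr => j _; rewrite at_distance1E (at_distanceE 2) /bond.
by case: (ndiff i j) => [|[|[|n]]] /=; rewrite ?adde0 ?add0e.
Qed.

Lemma bond_rest k i j : (0 < k)%N -> bond k i j (Num.sqrt (ndiff i j)%:R) = 0%E.
Proof.
move=> k0; rewrite /bond; case: eqP => [->|_].
  by rewrite sqrtr1 (potential_rest NNP) // mule0.
case: eqP => [->|//].
by rewrite divff ?gt_eqF ?sqrtr_gt0 // (potential_rest NNNP) // mule0.
Qed.

Hypothesis limNN : fracture_limit WbNN omegaNN.
Hypothesis limNNN : fracture_limit WbNNN omegaNNN.
Hypothesis ndNN : nondecreasing_from1 WNN.
Hypothesis ndNNN : nondecreasing_from1 WNNN.

Lemma bond_limit_ge0 i j : 0 <= bond_limit i j.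
Proof.
have NN0 := fracture_limit_gt0 NNP limNN.
have NNN0 := fracture_limit_gt0 NNNP limNNN.
by rewrite /bond_limit; case: ifP => _; [|case: ifP => _ //];
  rewrite mulr_ge0 // ltW.
Qed.

Lemma bond_limit_gt0 i j : (ndiff i j == 1)%N || (ndiff i j == 2)%N -> 0 < bond_limit i j.
Proof.
have NN0 := fracture_limit_gt0 NNP limNN.
have NNN0 := fracture_limit_gt0 NNNP limNNN.
by rewrite /bond_limit => /orP[] /eqP -> /=; rewrite mulr_gt0.
Qed.

Lemma bond_le_limit k i j l : (0 < k)%N -> Num.sqrt (ndiff i j)%:R <= l ->
  (k%:R%:E * bond k i j l <= (bond_limit i j)%:E)%E.
Proof.
move=> k0; rewrite /bond /bond_limit; case: eqP => [->|_].
  rewrite sqrtr1 => l1; rewrite muleCA EFinM lee_wpmul2l ?lee_fin //.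
  exact: (scaled_potential_le_limit cfP NNP).
case: eqP => [->|_ _]; last by rewrite mule0.
move=> l1; rewrite muleCA EFinM lee_wpmul2l ?lee_fin //.
apply: (scaled_potential_le_limit cfP NNNP) => //.
by rewrite ler_pdivlMr ?sqrtr_gt0 // mul1r.
Qed.

Lemma bond_ge_limit eps : 0 < eps -> exists N : nat, forall k i j l,
  (N <= k)%N -> N%:R <= l ->
  ((bond_limit i j - eps)%:E <= k%:R%:E * bond k i j l)%E.
Proof.
move=> e0.
have [N1 N1P] := scaled_potential_ge cfP NNP limNN ndNN e0.
have [N2 N2P] := scaled_potential_ge cfP NNNP limNNN ndNNN e0.
have sq2 : Num.sqrt 2 <= 2 :> R.
  have : Num.sqrt 2 ^+ 2 = 2 :> R by rewrite sqr_sqrtr.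
  by have := sqrtr_ge0 (2 : R); nra.
(* [N2] is doubled because next-to-nearest lengths are divided by [Num.sqrt 2 <= 2]; the successor
   makes [k] positive. The weights 1/8 and 1/4 only reduce the error [eps]. *)
exists (N1 + N2 + N2).+1 => k i j l Nk Nl.
have k0 : (0 < k)%N by lia.
have {}Nl : N1%:R + N2%:R + N2%:R + 1 <= l by move: Nl; rewrite -addn1 !natrD.
have N10 : 0 <= N1%:R :> R by [].
have N20 : 0 <= N2%:R :> R by [].
rewrite /bond /bond_limit; case: eqP => _.
  rewrite muleCA; apply: (@le_trans _ _ ((8^-1)%:E * (omegaNN - eps)%:E)%E).
    by rewrite -EFinM lee_fin; lra.
  by rewrite lee_wpmul2l ?lee_fin //; apply: N1P; [lia|lra].
case: eqP => _; last by rewrite mule0 lee_fin; lra.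
rewrite muleCA; apply: (@le_trans _ _ ((4^-1)%:E * (omegaNNN - eps)%:E)%E).
  by rewrite -EFinM lee_fin; lra.
rewrite lee_wpmul2l ?lee_fin //; apply: N2P; first lia.
rewrite ler_pdivlMr ?sqrtr_gt0 //; nra.
Qed.

End Bond.

(** * Finite sums, the lattice of the cross section, and upper limits *)

Lemma finite_grid (R : realType) (c B : R) :
  finite_set [set t : R | t - c \is a Num.int /\ `|t| <= B].
Proof.
pose N := (Num.truncn (B + `|c|)).+1.
apply: (@sub_finite_set _ _ [set n%:R - N%:R + c | n in `I_(N + N)]); last first.
  exact/finite_image/finite_II.
move=> t [/intrP [z tz] tB].
have : `|z%:~R| < N%:R :> R.
  apply: (@le_lt_trans _ _ (B + `|c|)); last by rewrite truncnS_gt.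
  by rewrite -tz (le_trans (ler_normB _ _)) // lerD2r.
rewrite -intr_norm -[ltRHS]/((N%:Z)%:~R) ltr_int => zN.
exists (absz (z + N%:Z)); first by rewrite /=; lia.
have -> : (absz (z + N%:Z))%:R = (z + N%:Z)%:~R :> R.
  by rewrite natr_absz ger0_norm //; lia.
by rewrite intrD addrK -tz subrK.
Qed.

Lemma sum_seq_le_fsum (R : realType) (T : choiceType) (A : set T) (s : seq T)
    (F : T -> \bar R) : finite_set A -> uniq s -> {in s, forall x, A x} ->
  (forall x, A x -> 0 <= F x)%E ->
  (\sum_(x <- s) F x <= \sum_(x \in A) F x)%E.
Proof.
move=> finA us sA F0; rewrite fsbig_finite // [leRHS](bigID (mem s)) /= -[in leRHS]big_filter.
rewrite [X in (_ <= X + _)%E](perm_big s) /=; last first.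
  apply: uniq_perm => //; first by rewrite filter_uniq // finmap.fset_uniq.
  move=> x; rewrite mem_filter andbC; apply/andP/idP => [[]//|xs].
  split=> //; have xA : x \in finmap.enum_fset (fset_set A) 
    by rewrite in_fset_set // mem_set //; exact: sA.
  exact: xA.
rewrite leeDl //; rewrite big_seq_cond; apply: sume_ge0 => x /andP[xA _].
by apply: F0; have : x \in finmap.enum_fset (fset_set A) := xA; rewrite in_fset_set // inE.
Qed.

Lemma finite_set_uniq (T : choiceType) (A : set T) : finite_set A ->
  exists2 s : seq T, uniq s & forall x, A x <-> x \in s.
Proof.
case/finite_seqP => s ->; exists (undup s); first exact: undup_uniq.
by move=> x; rewrite mem_undup.
Qed.

Section Lattice.
Context {R : realType}.
Variable cells : set (R * R).
Hypothesis section : cross_section cells.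

Lemma section_dom_cell x' (p : R * R) : cells x' ->
  `|p.1 - x'.1| < 2^-1 -> `|p.2 - x'.2| < 2^-1 -> section_dom cells p.
Proof.
move=> cx p1 p2; rewrite /section_dom /interior /=.
have [e e0 [e1 e2]] : exists2 e : R, 0 < e &
    e <= 2^-1 - `|p.1 - x'.1| /\ e <= 2^-1 - `|p.2 - x'.2|.
  exists (Num.min (2^-1 - `|p.1 - x'.1|) (2^-1 - `|p.2 - x'.2|)).
    by rewrite lt_min !subr_gt0 p1 p2.
  by rewrite !ge_min !lexx orbT.
apply/nbhs_ballP; exists e => //= q [q1 q2]; exists x' => //.
split.
- rewrite -(subrKA p.1) (le_trans (ler_normD _ _)) //.
  move: q1; rewrite /ball /= distrC => q1; lra.
- rewrite -(subrKA p.2) (le_trans (ler_normD _ _)) //.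
  move: q2; rewrite /ball /= distrC => q2; lra.
Qed.

Lemma cells_nonempty : exists x', cells x'.
Proof.
by have [p /interior_subset [x' cx _]] := section_nonempty section; exists x'.
Qed.

Lemma cells_ext : cells `<=` lattice_ext cells.
Proof.
move=> x' cx; exists x' => //; exists 0, 0; split=> //.
by rewrite -[LHS]addr0.
Qed.

Lemma corner_atoms x' i : cells x' -> atoms cells (x' + z' i).
Proof.
move=> cx; rewrite z'E; set b1 := zbit _ i; set b2 := zbit _ i; split.
  move=> B /nbhs_ballP [e /= e0 eB].
  pose d := 2^-1 * Num.min e 2^-1.
  have [d0 de d1] : [/\ 0 < d, d < e & d < 2^-1].
    have m0 : 0 < Num.min e 2^-1 by rewrite lt_min e0 /=.
    rewrite /d.
    have me : Num.min e 2^-1 <= e by rewrite ge_min lexx.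
    have mh : Num.min e 2^-1 <= (2^-1 : R) by rewrite ge_min lexx orbT.
    split; lra.
  pose u (b : bool) : R := b%:R - 2^-1.
  (* The corner is moved towards the centre of the cell, by [d < e] in each coordinate, and thus
     into the open cell. *)
  pose q : R * R := (x'.1 + (1 - 2 * d) * u b1, x'.2 + (1 - 2 * d) * u b2).
  have u_lt b : `|(1 - 2 * d) * u b| < 2^-1.
    by rewrite ltr_norml /u; case: b => /=; apply/andP; split; lra.
  have u_ball b : `|(x'.1 + u b) - (x'.1 + (1 - 2 * d) * u b)| < e.
    by rewrite ltr_norml /u; case: b => /=; apply/andP; split; lra.
  have u_ball' b : `|(x'.2 + u b) - (x'.2 + (1 - 2 * d) * u b)| < e.
    by rewrite ltr_norml /u; case: b => /=; apply/andP; split; lra.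
  exists q; split.
    by apply: (section_dom_cell cx); rewrite /q /= addrC addKr.
  by apply: eB; split; [exact: u_ball | exact: u_ball'].
have [i1 i2] := cells_half_integer section cx.
have half (t : R) (b : bool) : t - 2^-1 \is a Num.int -> t + (b%:R - 2^-1) \is a Num.int.
  by move=> ti; rewrite addrCA rpredD // ?natr_int.
by split; exact: half.
Qed.

Lemma surf_corner_cell x' i : cells x' -> surf_corner cells x' i.
Proof. by move=> cx; rewrite /surf_corner mem_set //; exact: corner_atoms. Qed.

Lemma atoms_closure_ext : atoms cells `<=` closure (section_ext cells).
Proof.
move=> a [ca _]; apply: closureS ca => p sp; exists p => //.
by rewrite !subrr normr0.
Qed.

Lemma finite_lattice_ext : finite_set (lattice_ext cells).
Proof.
have [M [_ MP]] := section_bounded section.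
have {MP} cB x : cells x -> `|x.1| <= M + 1 /\ `|x.2| <= M + 1.
  move=> cx; have : section_dom cells x.
    by apply: (section_dom_cell cx); rewrite subrr normr0.
  move=> /(MP (M + 1)); rewrite ltrDl ltr01 => /(_ isT).
  by rewrite /= prod_normE ge_max => /andP[].
pose A := [set t : R | t - 2^-1 \is a Num.int /\ `|t| <= M + 2].
apply: (@sub_finite_set _ _ (A `*` A)); last first.
  by apply: finite_setX; exact: finite_grid.
move=> _ [a ca [i [j [i1 j1 ->]]]].
have [a1 a2] := cells_half_integer section ca; have [B1 B2] := cB _ ca.
have bnd (z : int) (t : R) : `|z| <= 1 -> `|t| <= M + 1 -> `|t + z%:~R| <= M + 2.
  move=> z1 tM; rewrite (le_trans (ler_normD _ _)) //.
  have : `|z%:~R| <= 1 :> R by rewrite -intr_norm -[leRHS]/(1%:~R) ler_int.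
  lra.
have int (z : int) (t : R) : t - 2^-1 \is a Num.int -> t + z%:~R - 2^-1 \is a Num.int.
  by move=> ti; rewrite addrAC rpredD ?intr_int.
by split; split => /=; auto.
Qed.

End Lattice.

Lemma limn_esup_ge_near (R : realType) (u : (\bar R)^nat) l :
  (\forall n \near \oo, l <= u n)%E -> (l <= limn_esup u)%E.
Proof.
move=> [N _ Nl]; rewrite limn_esup_lim; apply: lime_ge; first exact: is_cvg_esups.
near=> n; apply: (@le_trans _ _ (u (maxn n N))).
  by apply: Nl; rewrite /= leq_maxr.
by apply: ereal_sup_ubound; exists (maxn n N) => //=; rewrite leq_maxl.
Unshelve. all: by end_near. Qed.

Lemma limn_esup_le (R : realType) (u : (\bar R)^nat) l :
  (forall n, u n <= l)%E -> (limn_esup u <= l)%E.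
Proof.
move=> ul; rewrite limn_esup_lim; apply: lime_le; first exact: is_cvg_esups.
by near=> n; apply: ge_ereal_sup => _ [m _ <-].
Unshelve. all: by end_near. Qed.

(** * Rotations *)

Section SpecialOrthogonal.
Context {R : realType}.
Implicit Types A B Q : 'M[R]_3.

Lemma SO3_adj Q : SO3 Q -> \adj Q = Q^T.
Proof.
move=> [QQ dQ]; have QtQ : Q^T *m Q = 1%:M by apply: mulmx1C.
by rewrite -[LHS]mul1mx -QtQ -mulmxA mul_mx_adj dQ mulmx1.
Qed.

Lemma SO3_unit Q : SO3 Q -> Q \in unitmx.
Proof. by move=> [_ dQ]; rewrite unitmxE dQ unitr1. Qed.

(** A rotation is its own cofactor matrix, so its first column is the cross product of the other
    two. Lateral edges of a rigid slice only reveal these two. *)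
Lemma SO3_eq A B : SO3 A -> SO3 B ->
  (forall c b, b != ord0 -> A c b = B c b) -> A = B.
Proof.
move=> AP BP AB; apply/matrixP => c b.
have [->|b0] := eqVneq b ord0; last exact: AB.
have adjE Q : SO3 Q -> Q c ord0 = cofactor Q c ord0.
  by move=> /SO3_adj QE; rewrite -[Q in LHS]trmxK -QE !mxE.
rewrite !adjE // /cofactor; congr (_ * \det _).
by apply/matrixP => x y; rewrite !mxE; apply: AB.
Qed.

Lemma SO3_entry Q c b : SO3 Q -> `|Q c b| <= 1.
Proof.
move=> [/matrixP /(_ c c) + _]; rewrite !mxE eqxx (bigD1 b) //= mxE => QQ.
rewrite -(@ler_pXn2r _ 2) ?nnegrE // expr1n real_normK ?num_real //.
by rewrite expr2 -[leRHS]QQ lerDl sumr_ge0 // => x _; rewrite mxE -expr2 sqr_ge0.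
Qed.

Lemma mul_vec3 Q x y z c : (Q *m vec3 x y z) c ord0 =
  Q c ord0 * x + Q c (inord 1) * y + Q c (inord 2) * z.
Proof.
rewrite !mxE !big_ord_recl big_ord0 !mxE /= addr0 addrA.
by congr (_ + _ * _ + _ * _); congr (Q _ _); apply: val_inj; rewrite /= inordK.
Qed.

Lemma SO3_vec3_le Q x y z c : SO3 Q ->
  `|(Q *m vec3 x y z) c ord0| <= `|x| + `|y| + `|z|.
Proof.
move=> QP; rewrite mul_vec3.
have le a b : `|Q c b * a| <= `|a|.
  by rewrite normrM ler_piMl // SO3_entry.
by rewrite (le_trans (ler_normD _ _)) // lerD // (le_trans (ler_normD _ _)) // lerD.
Qed.

End SpecialOrthogonal.

(** * Slices of the rod and the layers of cells between them *)

Section Slices.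
Context {R : realType}.
Implicit Types (r : R) (k m M : nat) (v : R * (R * R) -> 'cV[R]_3).

(* Atom positions in the slices [w_1 = h (p - M)], in units of the interatomic
   distance. *)
Definition slice r k M v (p : nat) (a : R * R) : 'cV[R]_3 :=
  k%:R *: v (mesh r k * (p%:R - M%:R), a).

Definition slice_cell (P : nat -> R * R -> 'cV[R]_3) m (x' : R * R) : 'M[R]_(3, 8) :=
  \matrix_(j, i) P (m + zbit ord0 i)%N (x' + z' i) j ord0.

Definition layer r k M m : R := mesh r k * (m%:R - M%:R + 2^-1).

Lemma cell_values_slice r k M v m x' :
  cell_values r k v (layer r k M m, x') = slice_cell (slice r k M v) m x'.
Proof.
apply/matrixP => j i; rewrite !mxE /corner; congr (_ * v _ _ _).
by congr (_, _); rewrite /= z1E natrD /layer; ring.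
Qed.

Lemma mesh_gt0 r k : 0 < r -> (0 < k)%N -> 0 < mesh r k.
Proof. by move=> r0 k0; rewrite invr_gt0 mulr_gt0 // ltr0n. Qed.

Variable cells : set (R * R).
Hypothesis section : cross_section cells.

Lemma finite_Lam' r k : 0 < r -> (0 < k)%N -> finite_set (Lam' cells r k).
Proof.
move=> r0 k0; have h0 := mesh_gt0 r0 k0; set h := mesh r k in h0.
have hi : 0 < h^-1 by rewrite invr_gt0.
pose A := [set t : R | t - 2^-1 \is a Num.int /\ `|t| <= (1 + h) / h].
apply: (@sub_finite_set _ _ (((fun t => h * t) @` A) `*` lattice_ext cells)).
  move=> w [wi wb we]; split => //; exists (w.1 / h); last first.
    by rewrite mulrC divfK ?gt_eqF.
  split => //=; rewrite normrM [`|h^-1|]gtr0_norm //.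
  rewrite ler_pM2r // ler_norml; move: wb => /andP[].
  by rewrite -/h => ? ?; apply/andP; split; lra.
apply: finite_setX; last exact: finite_lattice_ext.
exact/finite_image/finite_grid.
Qed.

Lemma sum_slices_le r k M (s : seq (R * R)) (F : R * (R * R) -> \bar R) :
  0 < r -> (0 < k)%N -> M%:R <= r * k%:R -> uniq s ->
  {in s, forall x, lattice_ext cells x} ->
  (forall w, lattice_ext cells w.2 -> 0 <= F w)%E ->
  (\sum_(x <- s) \sum_(m < M + M) F (layer r k M m, x) <=
   \sum_(w \in Lam' cells r k) F w)%E.
Proof.
move=> r0 k0 Mrk us sE F0; have h0 := mesh_gt0 r0 k0.
pose t := [seq (layer r k M m, x) | x <- s, m <- iota 0 (M + M)].
have -> : (\sum_(x <- s) \sum_(m < M + M) F (layer r k M m, x) =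
           \sum_(w <- t) F w)%E.
  rewrite big_allpairs_dep; apply: eq_bigr => x _.
  by rewrite -(big_mkord xpredT (fun m => F (layer r k M m, x))) /index_iota subn0.
apply: sum_seq_le_fsum.
- exact: finite_Lam'.
- apply: allpairs_uniq => //; first exact: iota_uniq.
  move=> [x m] [y l] _ _ [/(mulfI (lt0r_neq0 h0)) /addIr /addIr /eqP].
  by rewrite eqr_nat => /eqP -> ->.
- move=> w /allpairsP [[x m] /= [xs ms ->]]; move: ms; rewrite mem_iota add0n.
  move=> /= mM; split => /=; last exact: sE.
    rewrite /layer mulrAC divff ?gt_eqF // mul1r addrK.
    by rewrite rpredB // natr_int.
  have hM : mesh r k * M%:R <= 1.
    by rewrite mulrC ler_pdivrMr ?mul1r ?mulr_gt0 ?ltr0n.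
  have mM' : m%:R + 1 <= M%:R + M%:R :> R by rewrite natr1 -natrD ler_nat.
  have m0 : 0 <= m%:R :> R by [].
  by rewrite /layer; apply/andP; split; nra.
- by move=> w [_ _ we]; apply: F0.
Qed.

Lemma slice_rigid_left r k M Q y v a : 0 < r -> (0 < k)%N -> M%:R <= r * k%:R ->
  3 / 4 * (r * k%:R) <= M%:R -> closure (section_ext cells) a ->
  rigid_on cells `[-1, - (3 / 4)] r k Q y v ->
  slice r k M v 0 a = Q *m vec3 (- M%:R) a.1 a.2 + k%:R *: y.
Proof.
move=> r0 k0 M1 M2 ca rig; rewrite /slice sub0r; have rk0 : 0 < r * k%:R :> R.
  by rewrite mulr_gt0 // ltr0n.
rewrite rig //; last first.
  rewrite /= in_itv /= mulrN /mesh lerN2 lerN2 mulrC.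
  by rewrite ler_pdivrMr // ler_pdivlMr // mul1r M1 M2.
rewrite scalerDr scalemxAr; congr (_ *m _ + _); apply/colP => c; rewrite !mxE.
have k1 : k%:R != 0 :> R by rewrite pnatr_eq0 -lt0n.
by case: c => -[|[|[|//]]] ? /=; rewrite /mesh; field; rewrite ?k1 ?gt_eqF.
Qed.

Lemma slice_rigid_right r k M Q y v a : 0 < r -> (0 < k)%N -> M%:R <= r * k%:R ->
  3 / 4 * (r * k%:R) <= M%:R -> closure (section_ext cells) a ->
  rigid_on cells `[3 / 4, 1] r k Q y v ->
  slice r k M v (M + M) a = Q *m vec3 M%:R a.1 a.2 + k%:R *: y.
Proof.
move=> r0 k0 M1 M2 ca rig; rewrite /slice natrD addrK; have rk0 : 0 < r * k%:R :> R.
  by rewrite mulr_gt0 // ltr0n.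
rewrite rig //; last first.
  rewrite /= in_itv /= /mesh [_^-1 * M%:R]mulrC.
  by rewrite ler_pdivlMr // [_ / (_ * _) <= 1]ler_pdivrMr // mul1r M1 M2.
rewrite scalerDr scalemxAr; congr (_ *m _ + _); apply/colP => c; rewrite !mxE.
have k1 : k%:R != 0 :> R by rewrite pnatr_eq0 -lt0n.
by case: c => -[|[|[|//]]] ? /=; rewrite /mesh; field; rewrite ?k1 ?gt_eqF.
Qed.

End Slices.

(** * Lower bound for a rotation *)

Section RotationLowerBound.
Context {R : realType}.
Implicit Types (P : nat -> R * R -> 'cV[R]_3).

Lemma SO3_1 : SO3 (1%:M : 'M[R]_3).
Proof. by split; rewrite ?det1 // /O3 /= trmx1 mulmx1. Qed.

Lemma edist_SO3bar_ge (y : 'M[R]_(3, 8)) t :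
  (forall Q, SO3 Q -> t <= enorm (y - Q *m Idbar)) -> t <= Defs.edist y SO3bar.
Proof.
move=> tP; apply: lb_le_inf.
  exists (enorm (y - 1%:M *m Idbar)); exists (1%:M *m Idbar) => //.
  by exists 1%:M => //; exact: SO3_1.
by move=> _ [_ [Q QP <-] <-]; exact: tP.
Qed.

Definition edge P (x' : R * R) (i1 i2 : 'I_8) (p : nat) : 'cV[R]_3 :=
  P p (x' + z' i2) - P p (x' + z' i1).

Lemma edgeE P x' i1 i2 p c : edge P x' i1 i2 p c ord0 =
  P p (x' + z' i2) c ord0 - P p (x' + z' i1) c ord0.
Proof. by rewrite !mxE. Qed.

(** With [A = gradbar y - Q *m Idbar], the axial bonds at the two ends of the edge are both [Q e_1]
    up to entries of [A]. In their difference [Q e_1] cancels and four entries of [A] remain, each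
    at most [enorm A]. *)
Lemma edge_increment P m x' i1 i2 c : ~~ zbit ord0 i1 -> ~~ zbit ord0 i2 ->
  `|edge P x' i1 i2 m.+1 c ord0 - edge P x' i1 i2 m c ord0|
    <= 4 * Defs.edist (gradbar (slice_cell P m x')) SO3bar.
Proof.
move=> z1 z2; rewrite mulrC -ler_pdivrMr //; apply: edist_SO3bar_ge => Q _.
set y := slice_cell P m x'; set A := gradbar y - Q *m Idbar.
have AE i : ~~ zbit ord0 i ->
    A c (flip i) - A c i = P m.+1 (x' + z' i) c ord0 - P m (x' + z' i) c ord0 - Q c ord0.
  move=> zi; have QE : (Q *m Idbar) c (flip i) = (Q *m Idbar) c i + Q c ord0.
    rewrite !mxE -[X in _ + X]mulr1 (bigD1 ord0) //= [in RHS](bigD1 ord0) //=.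
    rewrite !IdbarE zbit_flip (negbTE zi) /=.
    rewrite (eq_bigr (fun j => Q c j * Idbar j i)); last first.
      by move=> j j0; rewrite !IdbarE zbit_flip (negbTE j0).
    by rewrite (_ : true%:R = 1) //; ring.
  have yE : y c (flip i) = P m.+1 (x' + z' i) c ord0 /\ y c i = P m (x' + z' i) c ord0.
    by rewrite !mxE zbit_flip z'_flip (negbTE zi) /= addn1 addn0.
  have gE j : gradbar y c j = y c j - (8^-1 *: \sum_j0 col j0 y) c ord0.
    by rewrite /gradbar !mxE big_ord1 !mxE mulr1.
  have -> a b : A a b = gradbar y a b - (Q *m Idbar) a b by rewrite [LHS]mxE [X in _ + X]mxE.
  by rewrite [A c i]mxE [X in _ - (_ + X)]mxE QE !gE yE.1 yE.2; ring.
rewrite ler_pdivrMr // !edgeE.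
have := AE _ z1; have := AE _ z2; clearbody A.
have := enorm_entry A c (flip i1); have := enorm_entry A c (flip i2).
have := enorm_entry A c i1; have := enorm_entry A c i2.
rewrite !ler_norml => /andP[? ?] /andP[? ?] /andP[? ?] /andP[? ?] ? ?.
by apply/andP; split; lra.
Qed.

Variables (L : R) (cells : set (R * R)) (WNN WNNN : nat -> R -> \bar R)
  (chi : nat -> 'M[R]_(3, 8) -> R).
Hypothesis section : cross_section cells.
Let W := Wtot cells WNN WNNN chi.

Section Standing.
Variables (cfrac : nat -> R) (W0 : R * R -> 'M[R]_(3, 8) -> \bar R).
Hypothesis standing : standing_assumptions_for L cells WNN WNNN chi cfrac W0.

Lemma cell_energy_Wtot k x' : lattice_ext cells x' ->
  is_cell_energy L cells WNN WNNN chi k (W k x').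
Proof.
move=> xe; have [xc|xc] := boolP (x' \in cells).
  by apply: Or31; apply/funext => y; rewrite /W /Wtot xc.
apply: Or32; exists x'; last by apply/funext => y; rewrite /W /Wtot (negbTE xc).
by split => // cx; move/negP: xc; apply; rewrite inE.
Qed.

Lemma Wtot_ge0 k x' y : (0 < k)%N -> lattice_ext cells x' -> (0 <= W k x' y)%E.
Proof. by move=> k0 xe; exact: (W_ge0 standing y k0 (cell_energy_Wtot k xe)). Qed.

Lemma Wtot_rigid k x' Q c : (0 < k)%N -> lattice_ext cells x' -> SO3 Q ->
  W k x' (Q *m Idbar + translation c) = 0%E.
Proof.
by move=> k0 xe; exact: (W_min standing c k0 (cell_energy_Wtot k xe)).
Qed.

(* Either one cell of the column is broken, or the elastic energies add up by
   the Cauchy-Schwarz inequality. *)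
Lemma column_energy_ge (c1 : nat -> R) (cW a : R) k N P x' i1 i2 c :
  (forall y, cfrac k < Defs.edist (gradbar y) SO3bar -> ((c1 k)%:E <= Wcell WNN WNNN chi k y)%E) ->
  0 < cW ->
  (forall y, ((cW * Defs.edist (gradbar y) SO3bar ^+ 2)%:E <= W0 x' y)%E) ->
  (0 < k)%N -> (0 < N)%N -> cells x' -> ~~ zbit ord0 i1 -> ~~ zbit ord0 i2 ->
  0 < a -> a <= `|edge P x' i1 i2 N c ord0 - edge P x' i1 i2 0 c ord0| ->
  ((Num.min (k%:R * c1 k) (k%:R * cW * a ^+ 2 / (16 * N%:R)))%:E <=
    \sum_(m < N) k%:R%:E * W k x' (slice_cell P m x'))%E.
Proof.
move=> c1P cW0 cWP k0 N0 cx z1 z2 a0 aP.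
have xe := cells_ext cx.
have ge0 m : (0 <= k%:R%:E * W k x' (slice_cell P m x'))%E.
  by rewrite mule_ge0 ?lee_fin // Wtot_ge0.
pose D m := Defs.edist (gradbar (slice_cell P m x')) SO3bar.
case: (pselect (exists m : 'I_N, cfrac k < D m)) => [[m mP]|noD].
  apply: (@le_trans _ _ (k%:R%:E * (c1 k)%:E)%E).
    by rewrite -EFinM lee_fin ge_min lexx.
  rewrite (bigD1 m) //= -[leLHS]adde0 leeD ?sume_ge0 //.
  by rewrite lee_wpmul2l ?lee_fin // /W /Wtot mem_set //; apply: c1P.
apply: (@le_trans _ _ (k%:R * cW * a ^+ 2 / (16 * N%:R))%:E).
  by rewrite lee_fin ge_min lexx orbT.
have NR : 0 < N%:R :> R by rewrite ltr0n.
(* The Cauchy-Schwarz inequality in tangent form: [D^2 >= 2 t D - t^2], with [t] the smallest mean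
   of the [D m] that allows the total turn [a]. Summation gives
   [2 t (a/4) - t^2 N = a^2 / (16 N)]. *)
pose t := a / (4 * N%:R).
apply: (@le_trans _ _ (\sum_(m < N) (k%:R * (cW * (2 * t * D m - t ^+ 2)))%:E)%E).
  rewrite sumEFin lee_fin.
  have -> : \sum_(m < N) k%:R * (cW * (2 * t * D m - t ^+ 2)) =
      k%:R * cW * (2 * t * (\sum_(m < N) D m) - t ^+ 2 * N%:R).
    rewrite (eq_bigr (fun m : 'I_N => k%:R * cW * 2 * t * D m - k%:R * cW * t ^+ 2)).
      by rewrite sumrB -mulr_sumr sumr_const card_ord -mulr_natr; ring.
    by move=> m _; ring.
  have SD : a / 4 <= \sum_(m < N) D m.
    rewrite ler_pdivrMr // mulrC mulr_sumr (le_trans aP) //.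
    rewrite -(telescope_sumr (fun p => edge P x' i1 i2 p c ord0) (leq0n N)) big_mkord.
    rewrite (le_trans (ler_norm_sum _ _ _)) // ler_sum // => m _.
    exact: edge_increment.
  have t0 : 0 < t by rewrite divr_gt0 // mulr_gt0.
  rewrite -(mulrA (k%:R * cW)) ler_wpM2l ?mulr_ge0 ?(ltW cW0) //.
  have -> : a ^+ 2 / (16 * N%:R) = 2 * t * (a / 4) - t ^+ 2 * N%:R.
    by rewrite /t; field; rewrite gt_eqF.
  by rewrite lerD2r ler_wpM2l // mulr_ge0 // ltW.
apply: lee_sum => m _; rewrite EFinM lee_wpmul2l ?lee_fin //.
rewrite /W (W_elastic standing) //; last first.
  by rewrite leNgt; apply/negP => Dm; apply: noD; exists m.
apply: le_trans (cWP _); rewrite lee_fin ler_wpM2l ?(ltW cW0) // -/(D m).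
have := sqr_ge0 (D m - t); set d := D m => ?; nra.
Qed.

End Standing.
End RotationLowerBound.

Lemma cvg_entry (R : realType) m n (A : nat -> 'M[R]_(m, n)) (B : 'M[R]_(m, n)) i j :
  A @ \oo --> B -> (fun l => A l i j) @ \oo --> B i j.
Proof. by move=> AB; exact: (cvg_comp _ _ AB (@coord_continuous R m n i j B)). Qed.

Lemma cvg_eventually_ge (R : realType) (x : nat -> R) (l : R) : l != 0 ->
  x @ \oo --> l -> \forall n \near \oo, `|l| / 2 <= `|x n|.
Proof.
move=> l0 /cvgrPdist_lt /(_ (`|l| / 2)) xl.
have l1 : 0 < `|l| / 2 by rewrite divr_gt0 ?normr_gt0.
near=> n; have : `|l - x n| < `|l| / 2 by near: n; exact: xl.
have := ler_distD (x n) l 0; rewrite !subr0; lra.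
Unshelve. all: by end_near. Qed.

Section LowerBounds.
Context {R : realType}.
Variables (L : R) (cells : set (R * R)) (WNN WNNN : nat -> R -> \bar R)
  (chi : nat -> 'M[R]_(3, 8) -> R).
Hypothesis section : cross_section cells.
Let W := Wtot cells WNN WNNN chi.

Lemma admissible_near u Q r k v : admissible cells u Q r k v ->
  (forall e : R, 0 < e -> \forall n \near \oo, r n <= e) /\
  (forall A : R, \forall n \near \oo, A <= r n * (k n)%:R /\ A <= (k n)%:R).
Proof.
move=> [rk [_ r0] rkoo _].
have re (e : R) : 0 < e -> \forall n \near \oo, r n <= e.
  move=> e0; have /cvgrPdist_le /(_ e e0) := r0; apply: filterS => n.
  by rewrite sub0r normrN; apply: le_trans; exact: ler_norm.
split => // A; have /cvgryPge /(_ (Num.max A 0)) rkA := rkoo.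
near=> n; have : Num.max A 0 <= r n * (k n)%:R by near: n.
rewrite ge_max => /andP[A1 A0]; split => //.
apply: (le_trans A1); rewrite -[leRHS]mul1r ler_wpM2r //; near: n; exact: re.
Unshelve. all: by end_near. Qed.

(** Used with [x = r k]: the slices at distance [M] from the middle then lie in the rigid end
    intervals, which begin at 3/4 of the half length. For [x >= 4] the loss of 1 by rounding is at
    most [x / 4]. *)
Lemma truncn_bounds (x : R) : 4 <= x ->
  let M := Num.truncn x in [/\ M%:R <= x, 3 / 4 * x <= M%:R & (0 < M)%N].
Proof.
move=> x4 M; have x0 : 0 <= x by lra.
have /andP[M1 M2] := truncn_itv x0; rewrite -natr1 -/M in M1 M2; split => //.
  lra.
by rewrite -(ltr_nat R); lra.
Qed.

Variables (cfrac : nat -> R) (W0 : R * R -> 'M[R]_(3, 8) -> \bar R).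
Hypothesis standing : standing_assumptions_for L cells WNN WNNN chi cfrac W0.

Definition cell_energy_sum (r : R) k v : \bar R := (\sum_(w \in Lam' cells r k)
  (k%:R%:E * W k w.2 (cell_values r k v w)))%E.

Lemma cell_energy_sum_ge (r : R) k v M (s : seq (R * R)) :
  0 < r -> (0 < k)%N -> M%:R <= r * k%:R -> uniq s ->
  {in s, forall x, lattice_ext cells x} ->
  (\sum_(x <- s) \sum_(m < M + M)
     k%:R%:E * W k x (slice_cell (slice r k M v) m x) <= cell_energy_sum r k v)%E.
Proof.
move=> r0 k0 Mrk us sE.
under eq_bigr do under eq_bigr do rewrite -cell_values_slice.
rewrite /cell_energy_sum.
apply: (sum_slices_le section
  (F := fun w => (k%:R%:E * W k w.2 (cell_values r k v w))%E)) => // w we.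
by rewrite mule_ge0 ?lee_fin // (Wtot_ge0 standing).
Qed.

(** The bound is half the limit energy of one broken cell. It does not depend on the sequence, so it
    passes to the infimum in [cell_formula]. *)
Lemma rotation_lower_bound : exists2 l : R, 0 < l &
  forall u Q r k v, Q <> 1%:M -> admissible cells u Q r k v ->
  (l%:E <= limn_esup (fun n => cell_energy_sum (r n) (k n) (v n)))%E.
Proof.
have [c1 c1P [l l0 c1l]] := W_fracture standing.
have [cW cW0 cWP] := W0_coercive standing.
have [x' cx] := cells_nonempty section.
exists (l / 2); first lra.
move=> u Q r k v Q1 adm; have [re rkA] := admissible_near adm.
have [rkP _ _ [ym [yp [Rm [Rp [[RmP RpP] _ RQ]
  [ymn [ypn [Rmn [Rpn [rig _ _ Rmn_cvg Rpn_cvg]]]]]]]]]] := adm.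
(* The two limit rotations differ already in a lateral column [b], since these columns determine a
   rotation. *)
have [c [b b0 cb]] : exists c : 'I_3, exists2 b : 'I_3, b != ord0 & (Rp - Rm) c b != 0.
  apply: contrapT => no; apply: Q1; rewrite -RQ.
  suff -> : Rp = Rm by rewrite mulVmx ?SO3_unit.
  apply: SO3_eq => // c b b0; apply/eqP; rewrite -subr_eq0; apply/negPn/negP => cb.
  by apply: no; exists c, b => //; rewrite !mxE.
set a0 := (Rp - Rm) c b in cb.
have cvg_diff : (fun n => Rpn n c b - Rmn n c b) @ \oo --> a0.
  by rewrite /a0 mxE [X in _ + X]mxE; apply: cvgB; exact: cvg_entry.
(* The edge from [i1] to [i2] is the unit vector in the lateral direction [b]; on a rigid slice it
   becomes the column [b] of the rotation. *)
pose i1 : 'I_8 := inord 0; pose i2 : 'I_8 := inord (if b == inord 1 then 3 else 1).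
have zi1 (j : 'I_3) : zbit j i1 = false.
  by rewrite /zbit inordK //; case: j => -[|[|[|]]].
have zi2 (j : 'I_3) : zbit j i2 = (j == b).
  move: b0; rewrite /zbit /i2 -!val_eqE /= !inordK //; last by case: ifP.
  by case: (b) => -[|[|[|//]]] ? //= _; case: j => -[|[|[|//]]].
have kcl : \forall n \near \oo, l / 2 <= (k n)%:R * c1 (k n).
  have [N _ NP] : \forall m \near \oo, l / 2 < m%:R * c1 m.
    have /cvgrPdist_lt /(_ (l / 2)) := c1l; rewrite divr_gt0 // => /(_ isT).
    apply: filterS => m; rewrite ltr_distlC => /andP[+ _]; lra.
  have := rkA N%:R; apply: filterS => n [_]; rewrite ler_nat => Nk.
  by apply: ltW; exact: NP.
apply: limn_esup_ge_near; near=> n.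
have [r0 k0 _] := rkP n.
have rk4 : 4 <= r n * (k n)%:R by near: n; have := rkA 4; apply: filterS => n [].
have [M1 M2 M0] := truncn_bounds rk4; set M := Num.truncn _ in M1 M2 M0.
set P := slice (r n) (k n) M (v n).
have [_ _ rigm rigp] := rig n.
have ca i : closure (section_ext cells) (x' + z' i).
  by apply: (atoms_closure_ext (cells := cells)); apply: corner_atoms.
have aP : `|a0| / 2 <= `|edge P x' i1 i2 (M + M) c ord0 - edge P x' i1 i2 0 c ord0|.
  rewrite !edgeE /P !(slice_rigid_left r0 k0 M1 M2 (ca _) rigm).
  rewrite !(slice_rigid_right r0 k0 M1 M2 (ca _) rigp).
  set pm := _ *: ymn n; set pp := _ *: ypn n.
  have entry (A B : 'cV[R]_3) : (A + B) c ord0 = A c ord0 + B c ord0 by rewrite mxE.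
  rewrite !entry !mul_vec3 /= !IdbarE !zi1 !zi2.
  rewrite [leRHS](_ : _ = `|Rpn n c b - Rmn n c b|).
    by near: n; exact: (cvg_eventually_ge cb cvg_diff).
  have ne12 : (inord 1 == inord 2 :> 'I_3) = false by rewrite -val_eqE /= !inordK.
  have [->|b1] := eqVneq b (inord 1).
    by rewrite [_ == _]eq_sym ne12 /=; congr `|_|; ring.
  have -> : b = inord 2.
    apply: val_inj; rewrite /= inordK //; move: b0 b1; rewrite -!val_eqE /= inordK //.
    by case: (b) => -[|[|[|//]]].
  by rewrite eqxx /=; congr `|_|; ring.
have := @cell_energy_sum_ge (r n) (k n) (v n) M [:: x'] r0 k0 M1 isT.
rewrite big_seq1; have xin : {in [:: x'], forall x, lattice_ext cells x}.
  by move=> x; rewrite inE => /eqP ->; exact: cells_ext.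
move=> /(_ xin); apply: le_trans.
have a00 : 0 < `|a0| / 2 by rewrite divr_gt0 ?normr_gt0.
have := column_energy_ge (P := P) standing _ cW0 _ k0 _ cx _ _ a00 aP.
rewrite !zi1 !zi2 addn_gt0 M0 /= eq_sym => /(_ c1 (c1P _ k0).2).
move=> /(_ (fun y => cWP _ y cx) isT isT b0); apply: le_trans.
rewrite lee_fin le_min; apply/andP; split; first by near: n.
(* With turn [|a0| / 2] and [2 M <= 2 r k] cells, the elastic alternative is at least
   [cW |a0|^2 / (128 r)], which is [l / 2] at this threshold. *)
have rs : r n <= cW * `|a0| ^+ 2 / (64 * l).
  near: n; apply: re.
  by rewrite divr_gt0 ?mulr_gt0 ?normr_gt0.
have MR : 0 < M%:R :> R by rewrite ltr0n.
rewrite ler_pdivlMr ?mulr_gt0 ?ltr0n ?addn_gt0 ?M0 //.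
move: rs; rewrite ler_pdivlMr ?mulr_gt0 // natrD => rs.
have kR : 0 < (k n)%:R :> R by rewrite ltr0n.
have := ler_wpM2r (ltW kR) rs; nra.
Unshelve. all: by end_near. Qed.

End LowerBounds.

(** * Zigzag paths and the lower bound for a jump *)

Lemma long_step (R : realType) n (f : nat -> 'cV[R]_n) c N (K : R) :
  (0 < N)%N -> N%:R * K <= `|f N c ord0 - f 0%N c ord0| ->
  exists2 m, (m < N)%N & K <= enorm (f m - f m.+1).
Proof.
move=> N0 NK; apply: contrapT => no.
have lt m : (m < N)%N -> enorm (f m - f m.+1) < K.
  by move=> mN; rewrite ltNge; apply/negP => Km; apply: no; exists m.
move: NK; apply/negP; rewrite -ltNge.
rewrite -(telescope_sumr (fun m => f m c ord0) (leq0n N)) big_mkord.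
apply: (le_lt_trans (ler_norm_sum _ _ _)).
rewrite mulr_natl -[N in X in _ < X]card_ord -sumr_const; apply: ltr_sum.
  by apply/hasP; exists (Ordinal N0); rewrite ?mem_index_enum.
move=> m _; apply: le_lt_trans (lt m (ltn_ord m)).
have := enorm_entry (f m - f m.+1) c ord0.
by rewrite !mxE distrC.
Qed.

Lemma enormBC (R : realType) m n (A B : 'M[R]_(m, n)) : enorm (A - B) = enorm (B - A).
Proof. by rewrite -opprB enormN. Qed.

Section Crossing.
Context {R : realType}.
Variable cells : set (R * R).

Definition crossing (x' : R * R) : pred ('I_8 * 'I_8) := fun p =>
  [&& surf_corner cells x' p.1, surf_corner cells x' p.2 &
      zbit ord0 p.1 != zbit ord0 p.2].

(** The ends are also swapped, so that the first end stays in its slice; only the lateral positions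
    are exchanged. Axial bonds are fixed. *)
Definition reflect_bond (p : 'I_8 * 'I_8) := (flip p.2, flip p.1).

Lemma reflect_bondK : involutive reflect_bond.
Proof. by case=> i j; rewrite /reflect_bond /= !flipK. Qed.

Lemma crossing_reflect x' p : crossing x' (reflect_bond p) = crossing x' p.
Proof.
rewrite /crossing /surf_corner /= !z'_flip !zbit_flip /= [RHS]andbCA.
by congr [&& _, _ & _]; case: (zbit _ _); case: (zbit _ _).
Qed.

(* Reflecting a bond in the middle plane of its cell lets bonds of successive
   cells be joined to a zigzag path, so that each path through the rod contains
   one arbitrarily long bond. *)
Lemma reflected_bonds_ge (P : nat -> R * R -> 'cV[R]_3) (g : 'I_8 -> 'I_8 -> R -> \bar R)
    (x' : R * R) N i j (K : R) (l : \bar R) :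
  (0 < N)%N -> zbit ord0 i != zbit ord0 j ->
  (forall t, 0 <= t -> (0 <= g i j t)%E) -> (forall t, K <= t -> (l <= g i j t)%E) ->
  g (flip j) (flip i) = g i j ->
  (forall i1 i2, i1 \in [:: i; j] -> i2 \in [:: i; j] -> exists c,
    N%:R * K <= `|P N (x' + z' i2) c ord0 - P 0%N (x' + z' i1) c ord0|) ->
  (l + l <= \sum_(m < N) g i j (enorm (col i (slice_cell P m x') - col j (slice_cell P m x')))
    + \sum_(m < N) g (flip j) (flip i)
        (enorm (col (flip j) (slice_cell P m x') - col (flip i) (slice_cell P m x'))))%E.
Proof.
move=> N0 zij g0 gl -> far.
have colE m a : col a (slice_cell P m x') = P (m + zbit ord0 a)%N (x' + z' a).
  by apply/colP => c; rewrite !mxE.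
(* Two complementary paths, one for each [e], alternate between the lateral positions of [i] and
   [j]. In every layer one of them follows the bond and the other its reflection. *)
pose al e m := x' + z' (if odd m (+) e then j else i) : R * R.
pose d e m := enorm (P m (al e m) - P m.+1 (al e m.+1)).
have dl e : (l <= \sum_(m < N) g i j (d e m))%E.
  have [c cP] : exists c, N%:R * K <= `|P N (al e N) c ord0 - P 0%N (al e 0%N) c ord0|.
    by apply: far; case: ifP; rewrite !inE eqxx ?orbT.
  have [m mN Km] := long_step (f := fun m => P m (al e m)) N0 cP.
  rewrite (bigD1 (Ordinal mN)) //= -[leLHS]adde0 leeD //; first exact: gl.
  by apply: sume_ge0 => n _; apply: g0; exact: enorm_ge0.
rewrite -big_split /=.
apply: (le_trans (leeD (dl (zbit ord0 i)) (dl (~~ zbit ord0 i)))).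
rewrite -big_split /=; apply: lee_sum => m _.
rewrite !colE !zbit_flip !z'_flip /d /al /=.
move: zij; case: (zbit ord0 i); case: (zbit ord0 j) => //= _;
  case: (odd m) => /=; rewrite ?addn0 ?addn1.
all: rewrite ?[enorm (P m.+1 _ - _)]enormBC ?[enorm (P m.+1 _ - _)]enormBC //.
all: by rewrite addeC.
Qed.

Lemma sum_crossing_reflect x' (V : nmodType) (F : 'I_8 * 'I_8 -> V) :
  \sum_(p | crossing x' p) F (reflect_bond p) = \sum_(p | crossing x' p) F p.
Proof.
rewrite [RHS](reindex_inj (inv_inj reflect_bondK)).
by apply: eq_bigl => p; rewrite crossing_reflect.
Qed.

End Crossing.

Section JumpLowerBound.
Context {R : realType}.
Variables (L : R) (cells : set (R * R)) (cf Mb : nat -> R)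
  (WNN WNNN WbNN WbNNN : nat -> R -> \bar R) (W0NN W0NNN : R -> R)
  (chi : nat -> 'M[R]_(3, 8) -> R) (omegaNN omegaNNN : R)
  (cfrac : nat -> R) (W0 : R * R -> 'M[R]_(3, 8) -> \bar R).
Hypothesis section : cross_section cells.
Hypothesis cfP : frac_threshold cf.
Hypothesis NNP : pair_potential cf Mb WNN WbNN W0NN.
Hypothesis NNNP : pair_potential cf Mb WNNN WbNNN W0NNN.
Hypothesis penalty : orientation_penalty chi.
Hypothesis standing : standing_assumptions_for L cells WNN WNNN chi cfrac W0.
Hypothesis limNN : fracture_limit WbNN omegaNN.
Hypothesis limNNN : fracture_limit WbNNN omegaNNN.
Hypothesis ndNN : nondecreasing_from1 WNN.
Hypothesis ndNNN : nondecreasing_from1 WNNN.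
Let W := Wtot cells WNN WNNN chi.
Let B k (y : 'M[R]_(3, 8)) (p : 'I_8 * 'I_8) : \bar R :=
  bond WNN WNNN k p.1 p.2 (enorm (col p.1 y - col p.2 y)).
Let om (p : 'I_8 * 'I_8) : R := bond_limit omegaNN omegaNNN p.1 p.2.

Lemma WtotE k x' y : (0 < k)%N -> W k x' y =
  (\sum_(p | crossing cells x' p) B k y p
   + \sum_(p : 'I_8 * 'I_8 | surf_corner cells x' p.1 && surf_corner cells x' p.2
        && (zbit ord0 p.1 == zbit ord0 p.2)) B k y p
   + (if x' \in cells then chi k y else 0)%:E)%E.
Proof.
move=> k0; have -> : W k x' y = (bond_energy WNN WNNN (surf_corner cells x') k y
    + (if x' \in cells then chi k y else 0)%:E)%E.
  rewrite /W /Wtot; case: ifPn => [xc|_]; last by rewrite adde0.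
  have cx : cells x' by move: xc; rewrite inE.
  suff -> : surf_corner cells x' = predT by [].
  by apply/funext => i; rewrite (surf_corner_cell section).
rewrite (bond_energyE NNP NNNP) // pair_big /=; congr (_ + _)%E.
rewrite (bigID (fun p : 'I_8 * 'I_8 => zbit ord0 p.1 != zbit ord0 p.2)) /=.
congr (_ + _)%E; first by apply: eq_bigl => p; rewrite /crossing andbA.
by apply: eq_bigl => p; rewrite negbK.
Qed.

Lemma Wtot_ge_crossing k x' y : (0 < k)%N ->
  (\sum_(p | crossing cells x' p) B k y p <= W k x' y)%E.
Proof.
move=> k0; rewrite WtotE // -addeA leeDl // adde_ge0 //.
  by apply: sume_ge0 => p _; rewrite (bond_ge0 NNP NNNP) ?enorm_ge0.
rewrite lee_fin; case: ifP => // _.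
by have [C _ /(_ k y k0) /andP[]] := penalty_bounds penalty.
Qed.

Lemma lee_double (a : R) (x : \bar R) : ((a + a)%:E <= x + x -> a%:E <= x)%E.
Proof.
by case: x => [x| |]; rewrite ?leey // -EFinD !lee_fin => h; lra.
Qed.

(** In atomic units the ends of the rod are about [k |u|] apart, while a path has only
    [2 M <= 2 r k] steps. As [r] tends to 0, the mean step length diverges, so each path contains a
    bond that costs almost its limit energy. *)
Lemma jump_lower_bound (s : seq (R * R)) u Q r k v eps :
  uniq s -> (forall x, lattice_ext cells x <-> x \in s) ->
  u != 0 -> 0 < eps -> admissible cells u Q r k v ->
  ((\sum_(x <- s) \sum_(p | crossing cells x p) (om p - eps))%:E <=
   limn_esup (fun n => cell_energy_sum cells WNN WNNN chi (r n) (k n) (v n)))%E.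
Proof.
move=> us sP u0 e0 adm; have [re rkA] := admissible_near adm.
have [rkP _ _ [ym [yp [Rm [Rp [[RmP RpP] ymp RQ]
  [ymn [ypn [Rmn [Rpn [rig ymn_cvg ypn_cvg _ _]]]]]]]]]] := adm.
have [c uc] : exists c, u c ord0 != 0.
  apply: contrapT => no; move/eqP: u0; apply; apply/colP => c; rewrite mxE.
  by apply/eqP/negPn/negP => uc; apply: no; exists c.
have cvg_diff : (fun n => ypn n c ord0 - ymn n c ord0) @ \oo --> u c ord0.
  by rewrite -ymp mxE [X in _ + X]mxE; apply: cvgB; exact: cvg_entry.
have [N0 N0P] := bond_ge_limit cfP NNP NNNP limNN limNNN ndNN ndNNN e0.
have N8 : 0 < 8 * (N0%:R + 1) :> R by rewrite mulr_gt0 // ltr_wpDl.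
have uc0 : 0 < `|u c ord0| by rewrite normr_gt0.
pose C : R := \sum_(x <- s) (`|x.1| + `|x.2| + 1).
have CP x i : x \in s -> `|(x + z' i).1| + `|(x + z' i).2| <= C.
  move=> xs; rewrite /C (big_rem x) //=; apply: (@le_trans _ _ (`|x.1| + `|x.2| + 1)).
    have half (b : bool) : `|b%:R - 2^-1| <= 2^-1 :> R.
      by rewrite ler_norml; case: b => /=; apply/andP; split; lra.
    rewrite !IdbarE; have := ler_normD x.1 ((zbit (inord 1) i)%:R - 2^-1).
    have := ler_normD x.2 ((zbit (inord 2) i)%:R - 2^-1).
    have := half (zbit (inord 1) i); have := half (zbit (inord 2) i); lra.
  by rewrite lerDl sumr_ge0 // => y _; rewrite !addr_ge0.
apply: limn_esup_ge_near; near=> n.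
have [r0 k0 _] := rkP n.
have rk4 : 4 <= r n * (k n)%:R by near: n; have := rkA 4; apply: filterS => n [].
have [M1 M2 M0] := truncn_bounds rk4; set M := Num.truncn _ in M1 M2 M0.
set P := slice (r n) (k n) M (v n).
have [RmnP RpnP rigm rigp] := rig n.
(* The translations contribute at least [k |u_c| / 2], the rotated positions at most [M + C] on
   either side. The thresholds below give [2 M (N0 + 1) <= k |u_c| / 4] and [2 C <= k |u_c| / 4]. *)
have far x i1 i2 : x \in s -> surf_corner cells x i1 -> surf_corner cells x i2 ->
    (M + M)%:R * N0%:R <= `|P (M + M)%N (x + z' i2) c ord0 - P 0%N (x + z' i1) c ord0|.
  move=> xs; rewrite /surf_corner !inE => /(atoms_closure_ext (cells := cells)) c1.
  move=> /(atoms_closure_ext (cells := cells)) c2.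
  rewrite /P (slice_rigid_left r0 k0 M1 M2 c1 rigm) (slice_rigid_right r0 k0 M1 M2 c2 rigp).
  have entry (X Y : 'cV[R]_3) : (X + Y) c ord0 = X c ord0 + Y c ord0 by rewrite mxE.
  rewrite !entry; have := CP x i1 xs; have := CP x i2 xs.
  have := SO3_vec3_le (- M%:R) (x + z' i1).1 (x + z' i1).2 c RmnP.
  have := SO3_vec3_le M%:R (x + z' i2).1 (x + z' i2).2 c RpnP.
  rewrite normrN !(ger0_norm (ler0n R M)); set A1 := (Rpn n *m _) c ord0.
  set A2 := (Rmn n *m _) c ord0.
  rewrite !mxE => A1P A2P C1 C2.
  have diffP : `|u c ord0| / 2 <= `|ypn n c ord0 - ymn n c ord0|.
    by near: n; exact: (cvg_eventually_ge uc cvg_diff).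
  have rs : r n <= `|u c ord0| / (8 * (N0%:R + 1)).
    by near: n; apply: re; exact: divr_gt0 uc0 N8.
  have kC : 8 * C / `|u c ord0| <= (k n)%:R.
    by near: n; have := rkA (8 * C / `|u c ord0|); apply: filterS => m [].
  have kR : 0 < (k n)%:R :> R by rewrite ltr0n.
  rewrite ler_pdivlMr // in rs.
  rewrite ler_pdivrMr // in kC.
  have tri : (k n)%:R * `|ypn n c ord0 - ymn n c ord0| <=
      `|A1 + (k n)%:R * ypn n c ord0 - (A2 + (k n)%:R * ymn n c ord0)| + `|A1| + `|A2|.
    rewrite -{1}(ger0_norm (ltW kR)) -normrM.
    have -> : (k n)%:R * (ypn n c ord0 - ymn n c ord0) =
      (A1 + (k n)%:R * ypn n c ord0 - (A2 + (k n)%:R * ymn n c ord0)) - A1 + A2 by ring.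
    by rewrite (le_trans (ler_normD _ _)) // lerD2r ler_normB.
  have krs := ler_wpM2r (ltW kR) rs.
  have dk := ler_wpM2l (ltW kR) diffP.
  have MN := ler_wpM2r (ler0n R N0) M1.
  rewrite natrD; clear -A1P A2P C1 C2 krs dk MN kC tri M1; nra.
have N2 : (0 < M + M)%N by rewrite addn_gt0 M0.
have sE : {in s, forall x, lattice_ext cells x} by move=> x /sP.
apply: le_trans (cell_energy_sum_ge section standing (v n) r0 k0 M1 us sE).
rewrite -sumEFin big_seq [leRHS]big_seq; apply: lee_sum => x xs.
apply: (@le_trans _ _ (\sum_(p | crossing cells x p)
    \sum_(m < M + M) (k n)%:R%:E * B (k n) (slice_cell P m x) p)%E); last first.
  rewrite exchange_big /=; apply: lee_sum => m _.
  rewrite -ge0_sume_distrr; last first.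
    by move=> p _; rewrite (bond_ge0 NNP NNNP) ?enorm_ge0.
  by rewrite lee_wpmul2l ?lee_fin // Wtot_ge_crossing.
(* Only a bond together with its reflection can be estimated, so the sum is doubled and the second
   copy reindexed by reflection. *)
apply: lee_double; rewrite -[X in (_ <= _ + X)%E]sum_crossing_reflect -big_split /=.
rewrite -big_split /= -sumEFin; apply: lee_sum => -[i j] /and3P[/= ci cj zij].
have Nk : (N0 <= k n)%N.
  by near: n; have := rkA N0%:R; apply: filterS => m []; rewrite ler_nat.
rewrite EFinD /B /=.
apply: (@reflected_bonds_ge _ P
  (fun i j t => (k n)%:R%:E * bond WNN WNNN (k n) i j t)%E
  x (M + M)%N i j N0%:R (om (i, j) - eps)%:E N2 zij) => //.
- by move=> t t0; rewrite mule_ge0 ?lee_fin // (bond_ge0 NNP NNNP).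
- by move=> t Kt; apply: N0P.
- by rewrite bond_flip.
- have mem_c a : a \in [:: i; j] -> surf_corner cells x a.
    by rewrite in_cons mem_seq1 => /orP[] /eqP ->.
  move=> i1 i2 i1P i2P; exists c.
  exact: (far _ _ _ xs (mem_c _ i1P) (mem_c _ i2P)).
Unshelve. all: by end_near. Qed.

End JumpLowerBound.

(** * Choice of the shift that brings the broken parts into contact *)

Section Hinge.
Context {R : realType}.

(** Completing the square; [s0] is the larger root, and the alternative depends on whether it exists
    and is nonnegative. *)
Lemma last_root (A b c : R) : 0 < A ->
  (forall s, 0 <= s -> 0 < A * s ^+ 2 + b * s + c) \/
  exists2 s0, 0 <= s0 & A * s0 ^+ 2 + b * s0 + c = 0 /\
    forall s, s0 <= s -> 0 <= A * s ^+ 2 + b * s + c.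
Proof.
move=> A0; pose D := b ^+ 2 - 4 * A * c.
have fE s : 4 * A * (A * s ^+ 2 + b * s + c) = (2 * A * s + b) ^+ 2 - D.
  by rewrite /D; ring.
have A4 : 0 < 4 * A by rewrite mulr_gt0.
have [D0|D0] := ltP D 0.
  by left=> s _; rewrite -(pmulr_rgt0 _ A4) fE; have := sqr_ge0 (2 * A * s + b); lra.
have sD := sqr_sqrtr D0; have sD0 := sqrtr_ge0 D; set q := Num.sqrt D in sD sD0.
pose s0 := (q - b) / (2 * A).
have s0E : 2 * A * s0 + b = q by rewrite /s0; field; rewrite gt_eqF.
have mon s : s0 <= s -> q <= 2 * A * s + b.
  by move=> ss; rewrite -s0E lerD2r ler_pM2l // mulr_gt0.
have [s00|s00] := ltP s0 0.
  left=> s sge; rewrite -(pmulr_rgt0 _ A4) fE -sD.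
  have : q < 2 * A * s + b by rewrite -s0E ltrD2r ltr_pM2l ?mulr_gt0 //; lra.
  by move=> qs; rewrite subr_gt0 ltr_pXn2r ?nnegrE //; lra.
right; exists s0 => //; split.
  by apply: (mulfI (lt0r_neq0 A4)); rewrite fE mulr0 s0E sD subrr.
move=> s ss; rewrite -(pmulr_rge0 _ A4) fE -sD subr_ge0.
by have qs := mon s ss; rewrite ler_pXn2r ?nnegrE //; lra.
Qed.

(** Each quadratic will be the squared length of a bond minus its squared rest length, as a function
    of the displacement [s]. At the largest of all nonnegative roots none is negative; the bond that
    is too short at [s = 0] guarantees a root. *)
Lemma last_contact (T : eqType) (l : seq T) (A : R) (b c : T -> R) : 0 < A ->
  (exists2 p, p \in l & c p <= 0) ->
  exists2 s, 0 <= s & {in l, forall p, 0 <= A * s ^+ 2 + b p * s + c p} /\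
    exists2 p, p \in l & A * s ^+ 2 + b p * s + c p = 0.
Proof.
move=> A0 [p0 p0l cp0]; pose f p s := A * s ^+ 2 + b p * s + c p.
have [pos|[s s0 [sP sE]]] : (forall s, 0 <= s -> {in l, forall p, 0 < f p s}) \/
    exists2 s0, 0 <= s0 & (forall s, s0 <= s -> {in l, forall p, 0 <= f p s}) /\
      exists2 p, p \in l & f p s0 = 0.
- elim: l {p0l} => [|p l IH]; first by left.
  have [fpos|[s1 s10 [f1 fge]]] := last_root (b p) (c p) A0;
    case: IH => [IHpos|[s2 s20 [IHge [p2 p2l f2]]]].
  + left=> s s0 q; rewrite inE => /orP[/eqP ->|ql]; first exact: fpos.
    exact: IHpos.
  + right; exists s2 => //; split; last by exists p2 => //; rewrite inE p2l orbT.
    move=> s ss q; rewrite inE => /orP[/eqP ->|ql]; last exact: IHge.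
    by apply/ltW/fpos; apply: le_trans ss.
  + right; exists s1 => //; split; last by exists p => //; rewrite inE eqxx.
    move=> s ss q; rewrite inE => /orP[/eqP ->|ql]; first exact: fge.
    by apply/ltW/IHpos => //; apply: le_trans ss.
  + right; exists (Num.max s1 s2); first by rewrite le_max s10.
    split.
      move=> s; rewrite ge_max => /andP[ss1 ss2] q; rewrite inE.
      by move=> /orP[/eqP ->|ql]; [exact: fge | exact: IHge].
    have [s12|s12] := leP s1 s2.
      by exists p2 => //; rewrite inE p2l orbT.
    by exists p => //; rewrite inE eqxx.
- by have := pos 0 (lexx 0) p0 p0l; rewrite /f expr0n /= !mulr0 !add0r ltNge cp0.
by exists s => //; split => //; exact: sP.
Qed.

Lemma seq_argmin (T : eqType) (l : seq T) (f : T -> R) : l != [::] ->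
  exists2 a, a \in l & {in l, forall b, f a <= f b}.
Proof.
elim: l => // x [|y l] IH _.
  by exists x; rewrite ?mem_head // => b; rewrite inE => /eqP ->.
have [a al aP] := IH isT; have [xa|ax] := leP (f x) (f a).
  exists x; rewrite ?mem_head // => b; rewrite inE => /orP[/eqP -> //|bl].
  by apply: (le_trans xa); exact: aP.
exists a; first by rewrite inE al orbT.
by move=> b; rewrite inE => /orP[/eqP ->|]; [exact: ltW | exact: aP].
Qed.

Variable Q : 'M[R]_3.

(* A cell of the fractured layer, in units of the interatomic distance: the left
   slice is undeformed, the right one is rotated by [Q] and shifted by [t]. *)
Definition hinge_cell (t : 'cV[R]_3) (x' : R * R) : 'M[R]_(3, 8) :=
  \matrix_(c, i) ((if zbit ord0 i then Q else 1%:M) *m vec3 0 (x' + z' i).1 (x' + z' i).2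
    + (zbit ord0 i)%:R *: t) c ord0.

Lemma hinge_cell_entry t x' c i : hinge_cell t x' c i =
  (if zbit ord0 i then Q else 1%:M) c (inord 1) * (x' + z' i).1
  + (if zbit ord0 i then Q else 1%:M) c (inord 2) * (x' + z' i).2
  + (zbit ord0 i)%:R * t c ord0.
Proof.
have entry (X Y : 'cV[R]_3) : (X + Y) c ord0 = X c ord0 + Y c ord0 by rewrite mxE.
by rewrite mxE entry mul_vec3 mulr0 add0r; congr (_ + _); rewrite mxE.
Qed.

Let tilt (a : R * R) c : R :=
  (Q - 1%:M) c (inord 1) * a.1 + (Q - 1%:M) c (inord 2) * a.2.

(** The cross product of the lateral columns of [1 + Q]. It may vanish. *)
Let normal : 'cV[R]_3 := \col_c cofactor (1%:M + Q) c ord0.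

(** The lateral columns of the matrix add up the contributions of both slices to those of [1 + Q];
    the axial one is twice the vector joining the centres of the two slices. Expanding along the
    latter makes the determinant affine in [t]. *)
Lemma det_hinge_cell t x' : \det (hinge_cell t x' *m Idbar^T) =
  2 * \sum_c (tilt x' c + t c ord0) * normal c ord0.
Proof.
rewrite (expand_det_col _ ord0) mulr_sumr; apply: eq_bigr => c _.
have sumE (F : bool -> bool -> bool -> R) :
    \sum_(i < 8) F (zbit ord0 i) (zbit (inord 1) i) (zbit (inord 2) i) =
    F false false false + F false false true + F false true true + F false true false
    + (F true false false + F true false true + F true true true + F true true false).
  by rewrite /zbit !inordK // !big_ord_recr big_ord0 /= !add0r !addrA.
have entry d b : (hinge_cell t x' *m Idbar^T) d b = \sum_i (
    (if zbit ord0 i then Q else 1%:M) d (inord 1) * (x'.1 + ((zbit (inord 1) i)%:R - 2^-1))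
  + (if zbit ord0 i then Q else 1%:M) d (inord 2) * (x'.2 + ((zbit (inord 2) i)%:R - 2^-1))
  + (zbit ord0 i)%:R * t d ord0) * ((zbit b i)%:R - 2^-1).
  by rewrite mxE; apply: eq_bigr => i _; rewrite hinge_cell_entry z'E mxE IdbarE.
have entry0 : (hinge_cell t x' *m Idbar^T) c ord0 = 2 * (tilt x' c + t c ord0).
  rewrite entry (sumE (fun b0 b1 b2 => (
    (if b0 then Q else 1%:M) c (inord 1) * (x'.1 + (b1%:R - 2^-1))
  + (if b0 then Q else 1%:M) c (inord 2) * (x'.2 + (b2%:R - 2^-1))
  + b0%:R * t c ord0) * (b0%:R - 2^-1))) /tilt.
  have QB b : (Q - 1%:M) c b = Q c b - (1%:M : 'M[R]_3) c b by rewrite !mxE.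
  by rewrite !QB /=; field.
have entry12 d b : b != ord0 -> (hinge_cell t x' *m Idbar^T) d b = (1%:M + Q) d b.
  have QD : (1%:M + Q) d b = (1%:M : 'M[R]_3) d b + Q d b by rewrite !mxE.
  move=> b0; rewrite entry QD; have [->|b1] := eqVneq b (inord 1).
    rewrite (sumE (fun b0 b1 b2 => (
      (if b0 then Q else 1%:M) d (inord 1) * (x'.1 + (b1%:R - 2^-1))
    + (if b0 then Q else 1%:M) d (inord 2) * (x'.2 + (b2%:R - 2^-1))
    + b0%:R * t d ord0) * (b1%:R - 2^-1))).
    by rewrite /=; field.
  have -> : b = inord 2.
    apply: val_inj; rewrite /= inordK //; move: b0 b1; rewrite -!val_eqE /= inordK //.
    by case: (b) => -[|[|[|//]]].
  rewrite (sumE (fun b0 b1 b2 => (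
    (if b0 then Q else 1%:M) d (inord 1) * (x'.1 + (b1%:R - 2^-1))
  + (if b0 then Q else 1%:M) d (inord 2) * (x'.2 + (b2%:R - 2^-1))
  + b0%:R * t d ord0) * (b2%:R - 2^-1))).
  by rewrite /=; field.
rewrite entry0 -mulrA; congr (_ * (_ * _)); rewrite mxE /cofactor; congr (_ * \det _).
by apply/matrixP => x y; rewrite [RHS]mxE [RHS]mxE [LHS]mxE [LHS]mxE entry12.
Qed.

(** The three claims are: no crossing bond is compressed, one is at rest, and no bulk cell reverses
    orientation. The shift is [t0 + sig *: e], where [t0] puts the atom [am] of least [height] onto
    its partner and [sig] is the last contact along [e]. *)
Lemma hinge (cells : set (R * R)) (s : seq (R * R)) : cross_section cells ->
  (forall x, lattice_ext cells x <-> x \in s) ->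
  exists t : 'cV[R]_3,
  [/\ forall x' p, x' \in s -> crossing cells x' p -> (ndiff p.1 p.2 <= 2)%N ->
        Num.sqrt (ndiff p.1 p.2)%:R <=
          enorm (col p.1 (hinge_cell t x') - col p.2 (hinge_cell t x')),
      exists x' p, [/\ x' \in s, crossing cells x' p, (0 < ndiff p.1 p.2 <= 2)%N &
        Num.sqrt (ndiff p.1 p.2)%:R =
          enorm (col p.1 (hinge_cell t x') - col p.2 (hinge_cell t x'))] &
      forall x', cells x' -> 0 <= \det (hinge_cell t x' *m Idbar^T)].
Proof.
move=> section sP.
pose height a := \sum_c tilt a c * normal c ord0.
pose la := [seq q | q <- [seq (x, i) | x <- s, i <- enum 'I_8] & surf_corner cells q.1 q.2].
have laP q : (q \in la) = (q.1 \in s) && surf_corner cells q.1 q.2.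
  rewrite /la map_id mem_filter andbC; congr (_ && _).
  apply/allpairsP/idP => [[[x i] /= [xs _ ->]]//|qs].
  by exists q; rewrite mem_enum qs; split => //; case: (q).
have [x0 cx0] := cells_nonempty section.
have cells_la x i : cells x -> (x, i) \in la.
  move=> cx; rewrite laP (surf_corner_cell section) // andbT.
  by apply/sP; apply: cells_ext.
have la0 : la != [::].
  by apply/eqP => la0; have := cells_la x0 ord0 cx0; rewrite la0.
have [[xm im] /=] := seq_argmin (fun q => height (q.1 + z' q.2)) la0.
rewrite laP /= => /andP[xms cim] hm; set am := xm + z' im in hm.
(* The direction is [normal] itself; if that vanishes, all determinants are zero and any nonzero
   vector will do. *)
have [e e0 en] : exists2 e : 'cV[R]_3, 0 < \sum_c e c ord0 ^+ 2 &
    0 <= \sum_c e c ord0 * normal c ord0.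
  have [n0|n0] := eqVneq (\sum_c normal c ord0 ^+ 2) 0.
    exists (const_mx 1).
      by rewrite !big_ord_recl big_ord0 !mxE; lra.
    rewrite big1 // => c _; have := n0; move/eqP.
    rewrite psumr_eq0; last by move=> *; exact: sqr_ge0.
    by move=> /allP /(_ c); rewrite mem_index_enum sqrf_eq0 => /(_ isT) /eqP ->; rewrite mulr0.
  exists normal; last by apply: sumr_ge0 => c _; rewrite -expr2 sqr_ge0.
  by rewrite lt_def n0 sumr_ge0 // => c _; exact: sqr_ge0.
pose t0 : 'cV[R]_3 := \col_c - tilt am c.
pose lp := [seq q <- [seq (x, p) | x <- s, p <- enum {: 'I_8 * 'I_8}] |
  crossing cells q.1 q.2 && (ndiff q.2.1 q.2.2 <= 2)%N].
have lpP q : (q \in lp) = [&& q.1 \in s, crossing cells q.1 q.2 & (ndiff q.2.1 q.2.2 <= 2)%N].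
  rewrite /lp mem_filter andbC; congr (_ && _).
  apply/allpairsP/idP => [[[x i] /= [xs _ ->]]//|qs].
  by exists q; rewrite mem_enum qs; split => //; case: (q).
(* A displacement by [sig *: e] changes a crossing bond vector by [sg p * sig *: e]. As the sign
   squares to 1, all squared lengths have the same leading coefficient. *)
pose sg (p : 'I_8 * 'I_8) : R := (zbit ord0 p.1)%:R - (zbit ord0 p.2)%:R.
pose D x p c : R := hinge_cell t0 x c p.1 - hinge_cell t0 x c p.2.
have normE x p sig : crossing cells x p ->
    enorm (col p.1 (hinge_cell (t0 + sig *: e) x) - col p.2 (hinge_cell (t0 + sig *: e) x)) ^+ 2
    = (\sum_c e c ord0 ^+ 2) * sig ^+ 2 + (2 * sg p * \sum_c D x p c * e c ord0) * sig
      + \sum_c D x p c ^+ 2.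
  move=> /and3P[_ _ zp]; rewrite enorm_col sqr_sqrtr; last first.
    by apply: sumr_ge0 => c _; exact: sqr_ge0.
  rewrite mulr_sumr !mulr_suml -!big_split /=; apply: eq_bigr => c _.
  have -> : (col p.1 (hinge_cell (t0 + sig *: e) x) -
      col p.2 (hinge_cell (t0 + sig *: e) x)) c ord0 = D x p c + sg p * sig * e c ord0.
    rewrite mxE [X in _ + X]mxE [col _ _ _ _]mxE [X in _ - X]mxE /D !hinge_cell_entry.
    have -> : (t0 + sig *: e) c ord0 = t0 c ord0 + sig * e c ord0 by rewrite mxE [X in _ + X]mxE.
    by rewrite /sg; ring.
  have sg2 : sg p ^+ 2 = 1.
    by rewrite /sg; move: zp; case: (zbit ord0 p.1); case: (zbit ord0 p.2) => //= _; ring.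
  rewrite [LHS](_ : _ = sg p ^+ 2 * (e c ord0 ^+ 2 * sig ^+ 2) +
    2 * sg p * (D x p c * e c ord0) * sig + D x p c ^+ 2); last by ring.
  by rewrite sg2 mul1r.
pose b (q : R * R * ('I_8 * 'I_8)) := 2 * sg q.2 * \sum_c D q.1 q.2 c * e c ord0.
pose c0 (q : R * R * ('I_8 * 'I_8)) := \sum_c D q.1 q.2 c ^+ 2 - (ndiff q.2.1 q.2.2)%:R.
have ndflip i : ndiff i (flip i) = 1%N.
  rewrite /ndiff (bigD1 ord0) //= zbit_flip eqxx /=.
  rewrite big1 => [|j j0]; first by case: (zbit _ _).
  by rewrite zbit_flip (negbTE j0) eqxx.
have [sig sig0 [sigP [[x1 p1] p1P sig1]]] : exists2 sig, 0 <= sig &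
    {in lp, forall q, 0 <= (\sum_c e c ord0 ^+ 2) * sig ^+ 2 + b q * sig + c0 q} /\
    exists2 q, q \in lp & (\sum_c e c ord0 ^+ 2) * sig ^+ 2 + b q * sig + c0 q = 0.
  (* The axial bond at [am] has length 0 for the shift [t0], hence is shorter than its rest length
     1. *)
  apply: last_contact e0 _; exists (xm, (im, flip im)).
    rewrite lpP /= xms /crossing /surf_corner /= z'_flip zbit_flip /=.
    rewrite -/(surf_corner cells xm im) cim ndflip.
    by case: (zbit _ _).
  rewrite /c0 /= ndflip big1 ?sub0r ?lerN10 // => c _.
  have QB d : (Q - 1%:M) c d = Q c d - (1%:M : 'M[R]_3) c d by rewrite !mxE.
  rewrite /D !hinge_cell_entry z'_flip -/am [t0 c ord0]mxE /tilt !QB zbit_flip.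
  by case: (zbit _ _) => /=; ring.
move: p1P; rewrite lpP => /and3P[/= x1s cr1 nd1].
exists (t0 + sig *: e); split.
- move=> x p xs cr nd; have : (x, p) \in lp by rewrite lpP /= xs cr.
  move=> /sigP; rewrite /c0 addrA -normE // subr_ge0 => ndE.
  by rewrite -[leRHS]ger0_norm ?enorm_ge0 // -sqrtr_sqr ler_wsqrtr.
- exists x1, p1; split => //.
    rewrite nd1 andbT lt0n; apply/negP => /eqP nd0.
    have /and3P[_ _] := cr1; move: nd0; rewrite /ndiff (bigD1 ord0) //=.
    by case: (_ != _).
  move: sig1; rewrite /c0 addrA -normE // => /eqP; rewrite subr_eq0 => /eqP <-.
  by rewrite sqrtr_sqr ger0_norm ?enorm_ge0.
- move=> x cx; rewrite det_hinge_cell mulr_ge0 //.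
  have -> : \sum_c (tilt x c + (t0 + sig *: e) c ord0) * normal c ord0 =
      (height x - height am) + sig * \sum_c e c ord0 * normal c ord0.
    rewrite /height mulr_sumr -sumrB -big_split /=; apply: eq_bigr => c _.
    have -> : (t0 + sig *: e) c ord0 = - tilt am c + sig * e c ord0.
      by rewrite mxE [X in _ + X]mxE mxE.
    ring.
  rewrite addr_ge0 ?mulr_ge0 // subr_ge0.
  have h0 := hm _ (cells_la x (inord 0) cx); have h2 := hm _ (cells_la x (inord 2) cx).
  rewrite /= in h0 h2.
  (* The centre of a bulk cell is the midpoint of two opposite atoms of a slice, whose heights are
     at least that of [am]. *)
  have -> : height x = (height (x + z' (inord 0)) + height (x + z' (inord 2))) / 2.
    rewrite /height -big_split mulr_suml /=; apply: eq_bigr => c _.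
    by rewrite /tilt !z'E /zbit !inordK //=; field.
  lra.
Qed.

End Hinge.

(** * Piecewise affine interpolation on blocks *)

Section PiecewiseAffine.
Context {R : realType}.

(* Interpolates the bilinear function [s y] of the corners [s, y = +-1/2] of a
   cell: both [s + y] and [s - y] have a constant sign on every simplex. *)
Definition twist (s y : R) : R := (`|s + y| - `|s - y|) / 4.

Lemma twist_corner (p q : bool) :
  twist (p%:R - 2^-1) (q%:R - 2^-1) = (p%:R - 2^-1) * (q%:R - 2^-1).
Proof.
rewrite /twist; case: p; case: q => /=;
  case: ger0P => h1; case: ger0P => h2; lra.
Qed.

Lemma twist_s0 s : twist s 0 = 0.
Proof. by rewrite /twist addr0 subr0 subrr mul0r. Qed.

Lemma twist_0y y : twist 0 y = 0.
Proof. by rewrite /twist add0r sub0r normrN subrr mul0r. Qed.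

(** The weights [b], [c], [d] belong to a face centre and two corners; the block centre is the
    origin. [j0] and [j1] say whether the face is orthogonal to the respective direction. Face
    centres have twist 0 and so leave no term on the right. *)
Lemma twist_simplex (j0 j1 p0 p1 q0 q1 : bool) (b c d : R) :
  0 <= b -> 0 <= c -> 0 <= d -> ~~ (j0 && j1) -> (j0 ==> (p0 == q0)) ->
  (j1 ==> (p1 == q1)) -> ((p0 != q0) ==> (p1 == q1)) ->
  twist (b * (if j0 then p0%:R - 2^-1 else 0) + c * (p0%:R - 2^-1) + d * (q0%:R - 2^-1))
        (b * (if j1 then p1%:R - 2^-1 else 0) + c * (p1%:R - 2^-1) + d * (q1%:R - 2^-1))
  = c * twist (p0%:R - 2^-1) (p1%:R - 2^-1) + d * twist (q0%:R - 2^-1) (q1%:R - 2^-1).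
Proof.
move=> b0 c0 d0; rewrite !twist_corner /twist.
case: j0; case: j1 => //= _; case: p0; case: q0 => //= _; case: p1; case: q1 => //= _ _;
  case: ger0P => h1; case: ger0P => h2; lra.
Qed.

Definition block_point (h : R) (w : R * (R * R)) (s y2 y3 : R) : R * (R * R) :=
  (w.1 + h * s, (w.2.1 + y2, w.2.2 + y3)).

(** Affine functions plus interpolations of [s y2] and [s y3], the products that appear when a
    linear map of the lateral position is switched on along the axis. *)
Definition block_form (a0 a1 a2 a3 b2 b3 s y2 y3 : R) : R :=
  a0 + a1 * s + a2 * y2 + a3 * y3 + b2 * twist s y2 + b3 * twist s y3.

Lemma corner_point h w i : corner h w i =
  block_point h w ((zbit ord0 i)%:R - 2^-1) ((zbit (inord 1) i)%:R - 2^-1)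
    ((zbit (inord 2) i)%:R - 2^-1).
Proof. by rewrite /corner /block_point z1E z'E. Qed.

Lemma same_faceE (j : 'I_3) i l : same_face (R := R) j i l = (zbit j l == zbit j i).
Proof.
rewrite /same_face !IdbarE (inj_eq (addIr _)).
by case: (zbit j l); case: (zbit j i); rewrite /= ?eqxx // ?oner_eq0 // eq_sym oner_eq0.
Qed.

Lemma sum_corners (F : bool -> bool -> bool -> R) :
  \sum_(i < 8) F (zbit ord0 i) (zbit (inord 1) i) (zbit (inord 2) i) =
  F false false false + F false false true + F false true true + F false true false
  + (F true false false + F true false true + F true true true + F true true false).
Proof. by rewrite /zbit !inordK // !big_ord_recr big_ord0 /= !add0r !addrA. Qed.

Lemma ord3P (j : 'I_3) : [\/ j = ord0, j = inord 1 | j = inord 2].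
Proof.
case: j => -[|[|[|//]]] l; [apply: Or31|apply: Or32|apply: Or33];
  by apply: val_inj; rewrite /= ?inordK.
Qed.

Lemma sum_face (j : 'I_3) i (F : bool -> bool -> bool -> R) :
  \sum_(l | same_face (R := R) j i l) F (zbit ord0 l) (zbit (inord 1) l) (zbit (inord 2) l) =
  let G p q := if j == ord0 then F (zbit j i) p q
    else if j == inord 1 then F p (zbit j i) q else F p q (zbit j i) in
  G false false + G false true + G true true + G true false.
Proof.
have n12 : (inord 1 == inord 2 :> 'I_3) = false by rewrite -val_eqE /= !inordK.
have n1 : (inord 1 == ord0 :> 'I_3) = false by rewrite -val_eqE /= !inordK.
have n2 : (inord 2 == ord0 :> 'I_3) = false by rewrite -val_eqE /= !inordK.
rewrite (eq_bigl (fun l => zbit j l == zbit j i)) => [|l]; last exact: same_faceE.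
move: (zbit j i) => b; rewrite big_mkcond /=.
have [->|->|->] := ord3P j; rewrite ?eqxx ?n1 ?n2 ?[inord 2 == _]eq_sym ?n12 /=.
- rewrite (sum_corners (fun b0 b1 b2 => if b0 == b then F b0 b1 b2 else 0)).
  by case: b => /=; ring.
- rewrite (sum_corners (fun b0 b1 b2 => if b1 == b then F b0 b1 b2 else 0)).
  by case: b => /=; ring.
- rewrite (sum_corners (fun b0 b1 b2 => if b2 == b then F b0 b1 b2 else 0)).
  by case: b => /=; ring.
Qed.

Lemma face_center_point h w (j : 'I_3) i : face_center h w j i = block_point h w
  (if j == ord0 then (zbit j i)%:R - 2^-1 else 0)
  (if j == inord 1 then (zbit j i)%:R - 2^-1 else 0)
  (if j == inord 2 then (zbit j i)%:R - 2^-1 else 0).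
Proof.
rewrite /face_center /block_point.
set S := (X in _ *: X).
have S1 : S.1 = \sum_(l | same_face (R := R) j i l) (corner h w l).1.
  by rewrite /S; elim/big_rec2: _ => // l x y _ <-.
have S2 : S.2.1 = \sum_(l | same_face (R := R) j i l) (corner h w l).2.1.
  by rewrite /S; elim/big_rec2: _ => // l x y _ <-.
have S3 : S.2.2 = \sum_(l | same_face (R := R) j i l) (corner h w l).2.2.
  by rewrite /S; elim/big_rec2: _ => // l x y _ <-.
have n12 : (inord 1 == inord 2 :> 'I_3) = false by rewrite -val_eqE /= !inordK.
have n1 : (inord 1 == ord0 :> 'I_3) = false by rewrite -val_eqE /= !inordK.
have n2 : (inord 2 == ord0 :> 'I_3) = false by rewrite -val_eqE /= !inordK.
transitivity ((4^-1 * S.1, (4^-1 * S.2.1, 4^-1 * S.2.2))); first by [].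
rewrite S1 S2 S3.
under eq_bigr do rewrite corner_point /=.
under [X in (_, (_ * X, _))]eq_bigr do rewrite corner_point /=.
under [X in (_, (_, _ * X))]eq_bigr do rewrite corner_point /=.
rewrite (sum_face j i (fun b0 b1 b2 => w.1 + h * (b0%:R - 2^-1))).
rewrite (sum_face j i (fun b0 b1 b2 => w.2.1 + (b1%:R - 2^-1))).
rewrite (sum_face j i (fun b0 b1 b2 => w.2.2 + (b2%:R - 2^-1))) /=.
have [->|->|->] := ord3P j;
  rewrite ?eqxx ?n1 ?n2 ?n12 ?[inord 2 == inord 1]eq_sym ?[ord0 == _]eq_sym ?n1 ?n2 ?n12 /=;
  congr (_, (_, _)); by field.
Qed.

End PiecewiseAffine.

Section Competitor.
Context {R : realType}.
Variable cells : set (R * R).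

Lemma norm_half (b : bool) : `|b%:R - 2^-1| <= 2^-1 :> R.
Proof. by rewrite ler_norml; case: b => /=; apply/andP; split; lra. Qed.

Lemma convex_half (b c d X Y Z : R) : 0 <= b -> 0 <= c -> 0 <= d -> b + c + d <= 1 ->
  `|X| <= 2^-1 -> `|Y| <= 2^-1 -> `|Z| <= 2^-1 -> `|b * X + c * Y + d * Z| <= 2^-1.
Proof.
rewrite !ler_norml => b0 c0 d0 s1 /andP[X1 X2] /andP[Y1 Y2] /andP[Z1 Z2].
have := ler_wpM2l b0 X1; have := ler_wpM2l b0 X2.
have := ler_wpM2l c0 Y1; have := ler_wpM2l c0 Y2.
have := ler_wpM2l d0 Z1; have := ler_wpM2l d0 Z2.
by move=> ? ? ? ? ? ?; apply/andP; split; lra.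
Qed.

(** The twists vanish at block and face centres, their averages over the corners of a block or a
    face are zero, and they are linear on each simplex. *)
Lemma PAff_block_form r k (v : R * (R * R) -> 'cV[R]_3) : 0 < r -> (0 < k)%N ->
  (forall w c, lattice_ext cells w.2 -> w.1 / mesh r k - 2^-1 \is a Num.int ->
    exists a0 a1 a2 a3 b2 b3 : R, forall s y2 y3,
      `|s| <= 2^-1 -> `|y2| <= 2^-1 -> `|y3| <= 2^-1 ->
      v (block_point (mesh r k) w s y2 y3) c ord0 = block_form a0 a1 a2 a3 b2 b3 s y2 y3) ->
  PAff cells r k v.
Proof.
move=> r0 k0 vP h w we corners; have h0 := mesh_gt0 r0 k0.
have wint : w.1 / mesh r k - 2^-1 \is a Num.int.
  have [+ _ _] := corners ord0; rewrite corner_point /= sub0r.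
  by rewrite mulrDl mulrN mulNr -/h mulrAC divff ?mul1r // gt_eqF.
have {}vP c := vP w c we wint.
have wE : w = block_point h w 0 0 0.
  by rewrite /block_point mulr0 !addr0 -!surjective_pairing.
have fh (b t : bool) : `|if b then t%:R - 2^-1 else 0| <= 2^-1 :> R.
  by case: b; rewrite ?norm_half // normr0; lra.
have entryZ (x : R) (X : 'cV[R]_3) c : (x *: X) c ord0 = x * X c ord0 by rewrite mxE.
have entryD (X Y : 'cV[R]_3) c : (X + Y) c ord0 = X c ord0 + Y c ord0 by rewrite mxE.
have half0 : `|0 : R| <= 2^-1 by rewrite normr0; lra.
have n12 : (inord 1 == inord 2 :> 'I_3) = false by rewrite -val_eqE /= !inordK.
have n1 : (inord 1 == ord0 :> 'I_3) = false by rewrite -val_eqE /= !inordK.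
have n2 : (inord 2 == ord0 :> 'I_3) = false by rewrite -val_eqE /= !inordK.
have fcE (j : 'I_3) i : face_center h w j i = block_point h w
    (if j == ord0 then (zbit ord0 i)%:R - 2^-1 else 0)
    (if j == inord 1 then (zbit (inord 1) i)%:R - 2^-1 else 0)
    (if j == inord 2 then (zbit (inord 2) i)%:R - 2^-1 else 0).
  rewrite face_center_point.
  by have [->|->|->] := ord3P j; rewrite ?eqxx ?n1 ?n2 ?n12 // ?[ord0 == _]eq_sym ?n1 ?n2
    ?[inord 2 == _]eq_sym ?n12.
split.
- apply/colP => c; rewrite entryZ summxE.
  have [a0 [a1 [a2 [a3 [b2 [b3 vE]]]]]] := vP c.
  under eq_bigr do rewrite corner_point vE ?norm_half // /block_form !twist_corner.
  rewrite [in LHS]wE vE // /block_form twist_s0.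
  rewrite (sum_corners (fun p0 p1 p2 => a0 + a1 * (p0%:R - 2^-1) + a2 * (p1%:R - 2^-1)
    + a3 * (p2%:R - 2^-1) + b2 * ((p0%:R - 2^-1) * (p1%:R - 2^-1))
    + b3 * ((p0%:R - 2^-1) * (p2%:R - 2^-1)))) /=.
  by field.
- move=> j i; apply/colP => c; rewrite entryZ summxE.
  have [a0 [a1 [a2 [a3 [b2 [b3 vE]]]]]] := vP c.
  under eq_bigr do rewrite corner_point vE ?norm_half // /block_form !twist_corner.
  rewrite fcE vE // /block_form.
  rewrite (sum_face j i (fun p0 p1 p2 => a0 + a1 * (p0%:R - 2^-1) + a2 * (p1%:R - 2^-1)
    + a3 * (p2%:R - 2^-1) + b2 * ((p0%:R - 2^-1) * (p1%:R - 2^-1))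
    + b3 * ((p0%:R - 2^-1) * (p2%:R - 2^-1)))) /=.
  have [->|->|->] := ord3P j; rewrite ?eqxx ?n1 ?n2 ?n12 ?[ord0 == _]eq_sym ?n1 ?n2
    ?[inord 2 == _]eq_sym ?n12 ?eqxx ?twist_s0 ?twist_0y /=; by field.
move=> j i l; rewrite same_faceE at_distance1E => /eqP fl /eqP nd a b c d ha hb hc hd abcd.
have nd' : ((zbit ord0 i != zbit ord0 l) + (zbit (inord 1) i != zbit (inord 1) l)
    + (zbit (inord 2) i != zbit (inord 2) l) = 1)%N.
  transitivity (ndiff i l); last exact: nd.
  rewrite /ndiff !big_ord_recl big_ord0 addn0 addnA.
  by congr (_ + _ + _)%N; congr (nat_of_bool (zbit _ _ != zbit _ _)); apply: val_inj;
    rewrite /= inordK.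
set p := a *: w + b *: face_center h w j i + c *: corner h w i + d *: corner h w l.
pose conv (X Y Z : R) := b * X + c * Y + d * Z.
have pE : p = block_point h w
    (conv (if j == ord0 then (zbit ord0 i)%:R - 2^-1 else 0)
      ((zbit ord0 i)%:R - 2^-1) ((zbit ord0 l)%:R - 2^-1))
    (conv (if j == inord 1 then (zbit (inord 1) i)%:R - 2^-1 else 0)
      ((zbit (inord 1) i)%:R - 2^-1) ((zbit (inord 1) l)%:R - 2^-1))
    (conv (if j == inord 2 then (zbit (inord 2) i)%:R - 2^-1 else 0)
      ((zbit (inord 2) i)%:R - 2^-1) ((zbit (inord 2) l)%:R - 2^-1)).
  rewrite /p fcE !corner_point /block_point /conv.
  have aE : a = 1 - b - c - d by lra.
  rewrite aE; case: (w) => w1 [w2 w3] /=.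
  have scE (x y : R) : x *: (y : R^o) = x * y by [].
  by congr (_, (_, _)); rewrite /= ?scE; ring.
have conv_half X Y Z : `|X| <= 2^-1 -> `|Y| <= 2^-1 -> `|Z| <= 2^-1 -> `|conv X Y Z| <= 2^-1.
  by move=> X1 Y1 Z1; apply: convex_half => //; lra.
apply/colP => e; rewrite !entryD !entryZ pE fcE !corner_point.
have [a0 [a1 [a2 [a3 [b2 [b3 vE]]]]]] := vP e.
have vw : v w e ord0 = block_form a0 a1 a2 a3 b2 b3 0 0 0 by rewrite {1}wE vE.
rewrite vw !vE ?conv_half ?norm_half //.
have jE (j' : 'I_3) : (j == j') ==> (zbit j' i == zbit j' l).
  by apply/implyP => /eqP <-; rewrite fl.
have jj (j' : 'I_3) : j' != ord0 -> ~~ ((j == ord0) && (j == j')).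
  by move=> j'0; apply/andP => -[/eqP -> /eqP j'E]; rewrite -j'E eqxx in j'0.
(* Adjacent corners differ in one bit only, so an edge never changes the axial and a lateral
   coordinate together. *)
have z01 : (zbit ord0 i != zbit ord0 l) ==> (zbit (inord 1) i == zbit (inord 1) l).
  clear -nd'; move: nd'.
  by case: (zbit ord0 i == _); case: (zbit (inord 1) i == _); case: (_ == _).
have z02 : (zbit ord0 i != zbit ord0 l) ==> (zbit (inord 2) i == zbit (inord 2) l).
  clear -nd'; move: nd'.
  by case: (zbit ord0 i == _); case: (zbit (inord 1) i == _); case: (_ == _).
rewrite /block_form /conv !twist_simplex ?jE ?jj ?z01 ?z02 ?n1 ?n2 //.
rewrite !twist_corner !twist_s0.
have tw0 (j' : 'I_3) x y : j' != ord0 ->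
    twist (if j == ord0 then x else 0) (if j == j' then y else 0) = 0 :> R.
  have [->|_] := eqVneq j ord0; last by rewrite twist_0y.
  by rewrite eq_sym => /negbTE ->; rewrite twist_s0.
by rewrite !tw0 ?n1 ?n2 // (_ : a = 1 - b - c - d); [ring | lra].
Qed.

Definition clamp (t : R) : R := Num.max 0 (Num.min t 1).

(** With [c] the midpoint of the lattice interval of [x], the product [clamp t * x] is expanded
    around [(1/2, c)] and its bilinear term replaced by a twist. *)
Definition shear (t x : R) : R :=
  let c := (Num.floor x)%:~R + 2^-1 in
  clamp t * c + (x - c) / 2 + twist (clamp t - 2^-1) (x - c).

Lemma clamp_le0 t : t <= 0 -> clamp t = 0.
Proof. by move=> t0; rewrite /clamp min_l ?max_l //; lra. Qed.

Lemma clamp_ge1 t : 1 <= t -> clamp t = 1.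
Proof. by move=> t1; rewrite /clamp min_r // max_r. Qed.

Lemma clamp_id t : 0 <= t -> t <= 1 -> clamp t = t.
Proof. by move=> t0 t1; rewrite /clamp min_l // max_r. Qed.

Lemma floor_center (x : R) : `|x - ((Num.floor x)%:~R + 2^-1)| <= 2^-1.
Proof.
have := floor_le x; have := lt_succ_floor x; rewrite intrD1.
by move=> x1 x2; rewrite ler_norml; apply/andP; split; lra.
Qed.

Lemma twist_half (y : R) : `|y| <= 2^-1 -> twist 2^-1 y = y / 2.
Proof.
rewrite ler_norml => /andP[y1 y2]; rewrite /twist !ger0_norm; lra.
Qed.

Lemma twistN (s y : R) : twist (- s) y = - twist s y.
Proof.
rewrite /twist [- s + y]addrC -[y - s]opprB normrN -[- s - y]opprD normrN.
by rewrite -mulNr opprB.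
Qed.

Lemma twistC (s y : R) : twist s y = twist y s.
Proof. by rewrite /twist [s + y]addrC [`|s - y|]distrC. Qed.

Lemma shear_le0 t x : t <= 0 -> shear t x = 0.
Proof.
move=> t0; rewrite /shear clamp_le0 // sub0r twistN twist_half ?floor_center //.
by rewrite mul0r add0r subrr.
Qed.

Lemma shear_ge1 t x : 1 <= t -> shear t x = x.
Proof.
move=> t1; rewrite /shear clamp_ge1 // (_ : 1 - 2^-1 = 2^-1 :> R); last by lra.
by rewrite twist_half ?floor_center //; lra.
Qed.

Lemma shear_mid s c y : c - 2^-1 \is a Num.int -> `|s| <= 2^-1 -> `|y| <= 2^-1 ->
  shear (2^-1 + s) (c + y) = (2^-1 + s) * c + y / 2 + twist s y.
Proof.
move=> /intrP [z cz] sh yh; have /andP[s1 s2] : - 2^-1 <= s <= 2^-1 by rewrite -ler_norml.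
have /andP[y1 y2] : - 2^-1 <= y <= 2^-1 by rewrite -ler_norml.
rewrite /shear clamp_id; [|lra|lra]; rewrite (_ : 2^-1 + s - 2^-1 = s); last by ring.
have cE : c = z%:~R + 2^-1 by lra.
(* At the right end the floor already selects the next interval; the formulas of both intervals
   agree there. *)
have [yE|yn] := eqVneq y 2^-1.
  have -> : Num.floor (c + y) = z + 1.
    by apply: floor_def; rewrite !intrD cE yE; apply/andP; split; lra.
  rewrite yE (_ : c + 2^-1 - _ = - 2^-1); last by rewrite intrD cE; lra.
  by rewrite [twist s _]twistC twistN [twist s _]twistC twist_half // intrD cE; lra.
have {}yn : y < 2^-1 by rewrite lt_neqAle yn.
have -> : Num.floor (c + y) = z.
  by apply: floor_def; rewrite intrD cE; apply/andP; split; lra.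
by rewrite -cE (_ : c + y - c = y); last by ring.
Qed.

(** [m] numbers the layers of blocks in units of the mesh. The kinks of the minimum, the maximum and
    [clamp] lie on slices, so everything is affine for [m < 0] and [m > 0]; the twist enters only in
    the fractured layer [m = 0]. *)
Lemma block_coefficients (m : int) : exists n0 n1 x0 x1 p q e f : R, forall s, `|s| <= 2^-1 ->
  let t := m%:~R + 2^-1 + s in
  [/\ Num.min t 0 = n0 + n1 * s, Num.max t 0 = x0 + x1 * s, clamp t = p + q * s &
    forall c y, c - 2^-1 \is a Num.int -> `|y| <= 2^-1 ->
      shear t (c + y) = (p + q * s) * c + e * y + f * twist s y].
Proof.
have [m0|m0|->] := ltgtP m 0.
- have m1 : m%:~R + 1 <= 0 :> R by rewrite -intrD1 -[leRHS]/(0%:~R) ler_int; lia.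
  exists (m%:~R + 2^-1), 1, 0, 0, 0, 0, 0, 0 => s; rewrite ler_norml => /andP[s1 s2] t.
  have t0 : t <= 0 by rewrite /t; lra.
  rewrite min_l // max_r // clamp_le0 //; split; rewrite /t; try lra.
  by move=> c y _ _; rewrite shear_le0 //; ring.
- have m1 : 1 <= m%:~R :> R by rewrite -[leLHS]/(1%:~R) ler_int; lia.
  exists 0, 0, (m%:~R + 2^-1), 1, 1, 0, 1, 0 => s; rewrite ler_norml => /andP[s1 s2] t.
  have t0 : 1 <= t by rewrite /t; lra.
  rewrite min_r ?max_l ?clamp_ge1 //; [|lra|lra]; split; rewrite /t; try lra.
  by move=> c y _ _; rewrite shear_ge1 //; ring.
- exists 0, 0, 2^-1, 1, 2^-1, 1, 2^-1, 1 => s sh; have := sh.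
  rewrite ler_norml => /andP[s1 s2] t.
  have tE : t = 2^-1 + s by rewrite /t add0r.
  rewrite tE min_r ?max_l ?clamp_id //; try lra; split; try lra.
  by move=> c y ci yh; rewrite shear_mid //; ring.
Qed.

End Competitor.

(** * The competitor for a pure rotation and its energy *)

Lemma fsum_le_sum_seq (R : realType) (T : choiceType) (A : set T) (s : seq T)
    (F : T -> \bar R) : finite_set A -> uniq s ->
  (forall x, A x -> x \notin s -> F x = 0%E) -> {in s, forall x, (0 <= F x)%E} ->
  (\sum_(x \in A) F x <= \sum_(x <- s) F x)%E.
Proof.
move=> finA us Fs F0; rewrite fsbig_finite //.
pose A' := finmap.enum_fset (fset_set A).
have A'P x : (x \in A') = (x \in A) by rewrite -in_fset_set.
rewrite -/A' (bigID (mem s)) /= [X in (_ + X)%E]big1_seq => [|x]; last first.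
  by move=> /andP[xs xA]; apply: Fs xs; apply/set_mem; rewrite -A'P; exact: xA.
rewrite adde0 -big_filter (perm_big [seq x <- s | x \in A']) /=; last first.
  apply: uniq_perm; rewrite ?filter_uniq ?finmap.fset_uniq //.
  by move=> x; rewrite !mem_filter andbC.
rewrite big_filter [leRHS](bigID (mem A')) /= leeDl // big_seq_cond.
by apply: sume_ge0 => x /andP[xs _]; exact: F0.
Qed.

Section HingeMap.
Context {R : realType}.
Variables (cells : set (R * R)) (Q : 'M[R]_3) (T : 'cV[R]_3).
Hypothesis section : cross_section cells.

Lemma lattice_ext_half x : lattice_ext cells x ->
  x.1 - 2^-1 \is a Num.int /\ x.2 - 2^-1 \is a Num.int.
Proof.
case=> a /(cells_half_integer section) [a1 a2] [i [j [_ _ ->]]] /=.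
by split; rewrite addrAC rpredD ?intr_int.
Qed.

(* The identity on the slices [t <= 0] and [x |-> Q x + T] on the slices
   [t >= 1], up to the factor [k]; [shear t] interpolates [clamp t * x]. *)
Definition hinge_map r k (w : R * (R * R)) : 'cV[R]_3 :=
  let t := w.1 * (r * k%:R) in
  \col_c (k%:R^-1 * ((1%:M : 'M[R]_3) c ord0 * Num.min t 0
    + (1%:M : 'M[R]_3) c (inord 1) * w.2.1 + (1%:M : 'M[R]_3) c (inord 2) * w.2.2
    + Q c ord0 * Num.max t 0 + T c ord0 * clamp t
    + (Q c (inord 1) - (1%:M : 'M[R]_3) c (inord 1)) * shear t w.2.1
    + (Q c (inord 2) - (1%:M : 'M[R]_3) c (inord 2)) * shear t w.2.2)).

Lemma hinge_map_left r k w : w.1 * (r * k%:R) <= 0 ->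
  hinge_map r k w = k%:R^-1 *: (1%:M *m vec3 (w.1 * (r * k%:R)) w.2.1 w.2.2).
Proof.
move=> t0; apply/colP => c; rewrite mxE [RHS]mxE mul_vec3.
by rewrite min_l // max_r // clamp_le0 // !shear_le0 //; congr (_ * _); ring.
Qed.

Lemma hinge_map_right r k w : 1 <= w.1 * (r * k%:R) ->
  hinge_map r k w = k%:R^-1 *: (Q *m vec3 (w.1 * (r * k%:R)) w.2.1 w.2.2 + T).
Proof.
move=> t1; have t0 : 0 <= w.1 * (r * k%:R) by apply: le_trans t1.
apply/colP => c; have entry (X : 'cV[R]_3) : (X + T) c ord0 = X c ord0 + T c ord0.
  by rewrite mxE.
rewrite mxE [RHS]mxE entry mul_vec3.
by rewrite min_r // max_l // clamp_ge1 // !shear_ge1 //; congr (_ * _); ring.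
Qed.

Lemma hinge_map_PAff r k : 0 < r -> (0 < k)%N -> PAff cells r k (hinge_map r k).
Proof.
move=> r0 k0; apply: PAff_block_form => // w c we /intrP [m mE].
have [x1 x2] := lattice_ext_half we.
have [n0 [n1 [y0 [y1 [p [q [e [f coef]]]]]]]] := @block_coefficients R m.
have kR : 0 < k%:R :> R by rewrite ltr0n.
pose I b := (1%:M : 'M[R]_3) c b; pose d b := Q c b - I b.
exists (k%:R^-1 * (I ord0 * n0 + I (inord 1) * w.2.1 + I (inord 2) * w.2.2 + Q c ord0 * y0
  + T c ord0 * p + d (inord 1) * p * w.2.1 + d (inord 2) * p * w.2.2)).
exists (k%:R^-1 * (I ord0 * n1 + Q c ord0 * y1 + T c ord0 * q
  + d (inord 1) * q * w.2.1 + d (inord 2) * q * w.2.2)).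
exists (k%:R^-1 * (I (inord 1) + d (inord 1) * e)).
exists (k%:R^-1 * (I (inord 2) + d (inord 2) * e)).
exists (k%:R^-1 * (d (inord 1) * f)), (k%:R^-1 * (d (inord 2) * f)) => s y2 y3 sh y2h y3h.
have tE : (block_point (mesh r k) w s y2 y3).1 * (r * k%:R) = m%:~R + 2^-1 + s.
  rewrite -mE /= /mesh subrK mulrDl; congr (_ + _); first by rewrite invrK.
  by field; rewrite !gt_eqF.
have [minE maxE clE shE] := coef s sh.
rewrite mxE tE minE maxE clE /= !shE // /block_form /d /I; ring.
Qed.

Lemma rigid_left r k : 0 < r -> (0 < k)%N ->
  rigid_on cells `[-1, - (3 / 4)] r k 1%:M 0 (hinge_map r k).
Proof.
move=> r0 k0 w1 x'; rewrite /= in_itv /= => /andP[_ w1l] _.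
have kR : 0 < k%:R :> R by rewrite ltr0n.
rewrite hinge_map_left; last first.
  by rewrite mulr_le0_ge0 ?mulr_ge0 ?ltW //=; lra.
rewrite addr0 scalemxAr; congr (_ *m _); apply/colP => c; rewrite !mxE.
by case: c => -[|[|[|//]]] ? /=; field; rewrite gt_eqF.
Qed.

Lemma rigid_right r k : 0 < r -> (0 < k)%N -> 2 <= r * k%:R ->
  rigid_on cells `[3 / 4, 1] r k Q (k%:R^-1 *: T) (hinge_map r k).
Proof.
move=> r0 k0 rk2 w1 x'; rewrite /= in_itv /= => /andP[w1l _] _.
have kR : 0 < k%:R :> R by rewrite ltr0n.
rewrite hinge_map_right; last by rewrite /=; nra.
rewrite scalerDr scalemxAr; congr (_ *m _ + _); apply/colP => c; rewrite !mxE.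
by case: c => -[|[|[|//]]] ? /=; field; rewrite gt_eqF.
Qed.

Lemma affine_cell (A : 'M[R]_3) (b : 'cV[R]_3) a x' c i :
  (A *m vec3 (a + (zbit ord0 i)%:R) (x' + z' i).1 (x' + z' i).2 + b) c ord0 =
  (A *m Idbar + translation (A *m vec3 (a + 2^-1) x'.1 x'.2 + b)) c i.
Proof.
have entry n (X Y : 'M[R]_(3, n)) j : (X + Y) c j = X c j + Y c j by rewrite mxE.
rewrite !entry /translation [(_ *m const_mx 1) _ _]mxE big_ord1 entry [const_mx _ _ _]mxE.
rewrite !mul_vec3 mulr1 mxE !big_ord_recl big_ord0 !IdbarE z'E /=.
rewrite (_ : lift ord0 ord0 = inord 1 :> 'I_3); last by apply: val_inj; rewrite /= inordK.
rewrite (_ : lift ord0 (lift ord0 ord0) = inord 2 :> 'I_3); last first.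
  by apply: val_inj; rewrite /= inordK.
ring.
Qed.

Lemma cell_values_hinge r k w (m : int) : 0 < r -> (0 < k)%N ->
  w.1 / mesh r k - 2^-1 = m%:~R ->
  cell_values r k (hinge_map r k) w =
    if m < 0 then 1%:M *m Idbar + translation (1%:M *m vec3 (m%:~R + 2^-1) w.2.1 w.2.2 + 0)
    else if 0 < m then Q *m Idbar + translation (Q *m vec3 (m%:~R + 2^-1) w.2.1 w.2.2 + T)
    else hinge_cell Q (T + Q *m vec3 1 0 0) w.2.
Proof.
move=> r0 k0 mE; have kR : 0 < k%:R :> R by rewrite ltr0n.
have kE (X : 'cV[R]_3) c : k%:R * (k%:R^-1 *: X) c ord0 = X c ord0.
  by rewrite mxE mulrA divff ?mul1r // gt_eqF.
have tE i : (corner (mesh r k) w i).1 * (r * k%:R) = m%:~R + (zbit ord0 i)%:R.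
  rewrite -mE /corner /= z1E /mesh invrK mulrDl; have := lt0r_neq0 r0.
  by move=> rn; field; rewrite rn gt_eqF.
have m1 : m < 0 -> m%:~R + 1 <= 0 :> R.
  by move=> m0; rewrite -intrD1 -[leRHS]/(0%:~R) ler_int; lia.
have m2 : 0 < m -> 1 <= m%:~R :> R.
  by move=> m0; rewrite -[leLHS]/(1%:~R) ler_int; lia.
have z01 i : (0 <= (zbit ord0 i)%:R :> R) && ((zbit ord0 i)%:R <= 1 :> R).
  by case: (zbit _ _); rewrite /= ?lexx ?ler01.
apply/matrixP => c i; rewrite mxE; have /andP[zi0 zi1] := z01 i.
have [m0|m0|m0] := ltgtP m 0.
- have := m1 m0 => m1'.
  rewrite hinge_map_left ?tE; last lra.
  by rewrite kE -affine_cell addr0.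
- have := m2 m0 => m2'.
  rewrite hinge_map_right ?tE; last lra.
  by rewrite kE -affine_cell.
rewrite hinge_cell_entry; move: (tE i); rewrite m0 add0r => tE0.
have TE : (T + Q *m vec3 1 0 0) c ord0 = T c ord0 + Q c ord0.
  by rewrite mxE mul_vec3; ring.
rewrite TE; case: (zbit ord0 i) in tE0 *.
  rewrite hinge_map_right ?tE0 // kE.
  rewrite mxE mul_vec3 /=; ring.
by rewrite hinge_map_left ?tE0 // kE mul_vec3 /=; ring.
Qed.

End HingeMap.

Lemma SO3_enorm (R : realType) (Q : 'M[R]_3) (x : 'cV[R]_3) : SO3 Q ->
  enorm (Q *m x) = enorm x.
Proof.
move=> [QQ _]; have QtQ : Q^T *m Q = 1%:M by apply: mulmx1C.
have sqE (y : 'cV[R]_3) : \sum_c y c ord0 ^+ 2 = (y^T *m y) ord0 ord0.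
  by rewrite mxE; apply: eq_bigr => c _; rewrite mxE expr2.
by rewrite !enorm_col !sqE trmx_mul -mulmxA (mulmxA Q^T) QtQ mul1mx.
Qed.

Section HingeEnergy.
Context {R : realType}.
Variables (L : R) (cells : set (R * R)) (cf Mb : nat -> R)
  (WNN WNNN WbNN WbNNN : nat -> R -> \bar R) (W0NN W0NNN : R -> R)
  (chi : nat -> 'M[R]_(3, 8) -> R)
  (cfrac : nat -> R) (W0 : R * R -> 'M[R]_(3, 8) -> \bar R).
Hypothesis section : cross_section cells.
Hypothesis NNP : pair_potential cf Mb WNN WbNN W0NN.
Hypothesis NNNP : pair_potential cf Mb WNNN WbNNN W0NNN.
Hypothesis penalty : orientation_penalty chi.
Hypothesis standing : standing_assumptions_for L cells WNN WNNN chi cfrac W0.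
Let W := Wtot cells WNN WNNN chi.

Variable Q : 'M[R]_3.
Hypothesis QP : SO3 Q.

Lemma hinge_cell_parallel t x' (p : 'I_8 * 'I_8) : zbit ord0 p.1 == zbit ord0 p.2 ->
  enorm (col p.1 (hinge_cell Q t x') - col p.2 (hinge_cell Q t x')) =
  Num.sqrt (ndiff p.1 p.2)%:R.
Proof.
move=> /eqP zp; rewrite -enorm_zdir.
have -> : col p.1 (hinge_cell Q t x') - col p.2 (hinge_cell Q t x') =
    (if zbit ord0 p.1 then Q else 1%:M) *m (zdir p.1 - zdir p.2).
  apply/colP => c; rewrite mxE [X in _ + X]mxE [col _ _ _ _]mxE [X in _ - X]mxE.
  rewrite !hinge_cell_entry -zp; set A := if _ then Q else _.
  have zE : zdir p.1 - zdir p.2 = vec3 0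
      ((zbit (inord 1) p.1)%:R - (zbit (inord 1) p.2)%:R)
      ((zbit (inord 2) p.1)%:R - (zbit (inord 2) p.2)%:R) :> 'cV[R]_3.
    apply/colP => d; rewrite !(mxE, IdbarE).
    have [->|->|->] := ord3P d; rewrite ?inordK //= ?zp; ring.
  by rewrite zE mul_vec3 !z'E /=; ring.
by case: (zbit _ _); rewrite ?mul1mx // SO3_enorm.
Qed.

(** Each slice moves rigidly, so its own bonds are at rest, and a nonnegative determinant puts the
    cell outside the support of the penalty. Only crossing bonds remain. *)
Lemma hinge_cell_energy_le k t x' (b : 'I_8 * 'I_8 -> R) : (0 < k)%N ->
  (cells x' -> 0 <= \det (hinge_cell Q t x' *m Idbar^T)) ->
  (forall p, crossing cells x' p -> (k%:R%:E * bond WNN WNNN k p.1 p.2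
     (enorm (col p.1 (hinge_cell Q t x') - col p.2 (hinge_cell Q t x'))) <= (b p)%:E)%E) ->
  (k%:R%:E * W k x' (hinge_cell Q t x') <= (\sum_(p | crossing cells x' p) b p)%:E)%E.
Proof.
move=> k0 detP bP; rewrite /W (WtotE chi section NNP NNNP) //.
rewrite [X in (_ + X + _)%E]big1 => [|p /andP[_ zp]]; last first.
  by rewrite hinge_cell_parallel // (bond_rest NNP NNNP).
have -> : (if x' \in cells then chi k (hinge_cell Q t x') else 0) = 0.
  case: ifP => // xc; have cx : cells x' by move: xc; rewrite inE.
  have [U [_ Uneg _ U0]] := penalty_support penalty; apply: U0 => // /Uneg.
  by rewrite /orientation_reversing /= ltNge detP.
rewrite !adde0 ge0_sume_distrr => [|p _]; last by rewrite (bond_ge0 NNP NNNP) ?enorm_ge0.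
by rewrite -sumEFin; apply: lee_sum.
Qed.

Lemma hinge_energy_le r k T (s : seq (R * R)) (B : R * R -> R) :
  0 < r -> (0 < k)%N -> uniq s -> (forall x, lattice_ext cells x <-> x \in s) ->
  (forall x, x \in s ->
    (k%:R%:E * W k x (hinge_cell Q (T + Q *m vec3 1 0 0) x) <= (B x)%:E)%E) ->
  (cell_energy_sum cells WNN WNNN chi r k (hinge_map Q T r k) <= (\sum_(x <- s) B x)%:E)%E.
Proof.
move=> r0 k0 us sP BP; have h0 := mesh_gt0 r0 k0.
rewrite /cell_energy_sum; set F := (fun w => _).
(* The midpoints of the cells of the fractured layer; all other cells are rigid and cost nothing. *)
pose l := [seq (mesh r k / 2, x) | x <- s].
apply: (@le_trans _ _ (\sum_(w <- l) F w)%E).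
  apply: fsum_le_sum_seq.
  - exact: finite_Lam'.
  - by rewrite map_inj_uniq // => x y [].
  - move=> w [/intrP [m mE] _ we] wl; rewrite /F (cell_values_hinge Q T r0 k0 mE).
    case: ltgtP => [m0|m0|m0].
    + by rewrite (Wtot_rigid standing) ?mule0 //; exact: SO3_1.
    + by rewrite (Wtot_rigid standing) ?mule0.
    case/negP: wl; apply/mapP; exists w.2; first exact/sP.
    rewrite [LHS]surjective_pairing; congr (_, _).
    move: mE; rewrite m0 => /eqP; rewrite subr_eq add0r => /eqP wE.
    by rewrite mulrC -wE divfK ?gt_eqF.
  - by move=> w /mapP [x xs ->]; rewrite /F mule_ge0 ?lee_fin // (Wtot_ge0 standing) //; exact/sP.
rewrite big_map -sumEFin big_seq [leRHS]big_seq; apply: lee_sum => x xs.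
rewrite /F (@cell_values_hinge _ Q T r k _ 0) //=; first exact: BP.
by rewrite mulrAC divff ?gt_eqF // mul1r subrr.
Qed.

End HingeEnergy.

(** The choice gives [r k = n + 2], which tends to infinity and is at least 2, so that the fractured
    layer ends before the right rigid interval. The translation [T / k] tends to 0. *)
Lemma hinge_admissible (R : realType) (cells : set (R * R)) (Q : 'M[R]_3) (T : 'cV[R]_3) :
  cross_section cells -> SO3 Q ->
  let r n := n.+2%:R^-1 in let k n := (n.+2 ^ 2)%N in
  admissible cells 0 Q r k (fun n => hinge_map Q T (r n) (k n)).
Proof.
move=> section QP r k.
have r0 n : 0 < r n by rewrite invr_gt0 ltr0n.
have k0 n : (0 < k n)%N by rewrite expn_gt0.
have rkE n : r n * (k n)%:R = n.+2%:R.
  by rewrite /r /k natrX expr2 mulKf // pnatr_eq0.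
have nS : (fun n => n.+2%:R : R) @ \oo --> +oo.
  apply/cvgryPge => A; near=> n; apply: (@le_trans _ _ n%:R); last by rewrite ler_nat; lia.
  by near: n; exact: nbhs_infty_ger.
have rcvg : r @ \oo --> (0 : R).
  apply/cvgrVy; first by near=> n; exact: r0.
  by apply: cvg_trans nS; apply: near_eq_cvg; near=> n; rewrite /= invrK.
split.
- by move=> n; split => //; exact: hinge_map_PAff.
- by split => // n; rewrite lef_pV2 ?posrE ?ltr0n // ler_nat.
- by apply: cvg_trans nS; apply: near_eq_cvg; near=> n; rewrite rkE.
exists 0, 0, 1%:M, Q; split; first by split => //; exact: SO3_1.
- by rewrite subr0.
- by rewrite invmx1 mul1mx.
exists (fun=> 0), (fun n => (k n)%:R^-1 *: T), (fun=> 1%:M), (fun=> Q); split.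
- move=> n; split => //; first exact: SO3_1.
    exact: rigid_left.
  by apply: rigid_right => //; rewrite rkE ler_nat.
- exact: cvg_cst.
- rewrite -[X in _ --> X](scale0r T); apply: cvgZr_tmp.
  have -> : (fun n => (k n)%:R^-1) = (fun n => r n * r n) :> (nat -> R).
    by apply/funext => n; rewrite /k /r natrX expr2 invfM.
  by rewrite -[X in _ --> X](mulr0 0); apply: cvgM.
- exact: cvg_cst.
- exact: cvg_cst.
Unshelve. all: by end_near. Qed.

Theorem proposition8p2 (R : realType) (L : R) (cells : set (R * R))
  (cf Mb : nat -> R)
  (WNN WNNN WbNN WbNNN : nat -> R -> \bar R) (W0NN W0NNN : R -> R)
  (chi : nat -> 'M[R]_(3, 8) -> R) (omegaNN omegaNNN : R)
  (L_gt0 : 0 < L)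
  (section : cross_section cells)
  (cf_threshold : frac_threshold cf)
  (Mb_threshold : long_range_threshold Mb)
  (potential_NN : pair_potential cf Mb WNN WbNN W0NN)
  (potential_NNN : pair_potential cf Mb WNNN WbNNN W0NNN)
  (penalty : orientation_penalty chi)
  (standing : standing_assumptions L cells WNN WNNN chi)
  (limit_NN : fracture_limit WbNN omegaNN)
  (limit_NNN : fracture_limit WbNNN omegaNNN)
  (nondecreasing_NN : nondecreasing_from1 WNN)
  (nondecreasing_NNN : nondecreasing_from1 WNNN) :
  let phi := cell_formula cells (Wtot cells WNN WNNN chi) in
  forall (Q Qt : 'M[R]_3) (u : 'cV[R]_3),
    SO3 Q -> SO3 Qt -> Q <> 1%:M -> u <> 0 ->
    (0 < phi 0%R Q)%E /\ (phi 0%R Q < phi u Qt)%E.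
Proof.
move=> phi Q Qt u QP QtP Q1 u0.
have [cfrac [W0 st]] := standing.
have energyE r k v : (\sum_(w \in Lam' cells r k)
    (k%:R%:E * Wtot cells WNN WNNN chi k w.2 (cell_values r k v w)))%E =
    cell_energy_sum cells WNN WNNN chi r k v by [].
split.
  have [l l0 lP] := rotation_lower_bound section st.
  apply: (@lt_le_trans _ _ l%:E); first by rewrite lte_fin.
  by apply: le_ereal_inf_tmp => _ [r [k [v [adm ->]]]]; exact: lP adm.
have [s us sP] := finite_set_uniq (finite_lattice_ext section).
pose om (p : 'I_8 * 'I_8) : R := bond_limit omegaNN omegaNNN p.1 p.2.
have [t [farP [x1 [p1 [x1s cr1 nd1 contact]]] detP]] := hinge Q section sP.
have om1 : 0 < om p1.
  apply: (bond_limit_gt0 potential_NN potential_NNN limit_NN limit_NNN).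
  by case: (ndiff _ _) nd1 => [|[|[|]]].
(* [hinge_cell] rotates the right slice about the plane of the left one, whereas [hinge_map] rotates
   it from its own position one lattice spacing further. *)
pose T := t - Q *m vec3 1 0 0.
pose b x p : R := if (x == x1) && (p == p1) then 0 else om p.
pose U : R := \sum_(x <- s) \sum_(p | crossing cells x p) b x p.
have upper : (phi 0%R Q <= U%:E)%E.
  have adm := hinge_admissible T section QP.
  apply: (le_trans (ereal_inf_lbound _)).
    exists (fun n => n.+2%:R^-1), (fun n => (n.+2 ^ 2)%N).
    exists (fun n => hinge_map Q T n.+2%:R^-1 (n.+2 ^ 2)%N).
    by split; [exact: adm | reflexivity].
  apply: limn_esup_le => n; rewrite energyE.
  have k0 : (0 < n.+2 ^ 2)%N by rewrite expn_gt0.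
  apply: (hinge_energy_le section st QP) => //.
  move=> x xs; rewrite subrK.
  apply: (hinge_cell_energy_le section potential_NN potential_NNN penalty QP) => //.
    by move=> cx; exact: detP.
  move=> p crp; rewrite /b; case: ifPn => [/andP[/eqP -> /eqP ->]|_].
    by rewrite -contact (bond_rest potential_NN potential_NNN) // mule0.
  have [nd2|nd3] := leqP (ndiff p.1 p.2) 2.
    apply: (bond_le_limit cf_threshold potential_NN potential_NNN limit_NN limit_NNN) => //.
    exact: farP.
  (* Space diagonals are not controlled by [hinge], but they carry no energy. *)
  have {}nd3 : ndiff p.1 p.2 = 3 by apply/eqP; rewrite eqn_leq ndiff_le3.
  by rewrite /om /bond /bond_limit nd3 /= mule0.
pose N : R := \sum_(x <- s) \sum_(p | crossing cells x p) 1.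
have N0 : 0 <= N by apply: sumr_ge0 => x _; apply: sumr_ge0.
(* [N] counts the crossing pairs over all cells, so the total loss [eps * N] stays below the energy
   [om p1] saved by the bond in contact. *)
pose eps := om p1 / (2 * (N + 1)).
have eps0 : 0 < eps by rewrite divr_gt0 // mulr_gt0 // ltr_wpDl.
apply: (le_lt_trans upper).
apply: (@lt_le_trans _ _
  (\sum_(x <- s) \sum_(p | crossing cells x p) (om p - eps))%:E); last first.
  apply: le_ereal_inf_tmp => _ [r [k [v [adm ->]]]].
  apply: (jump_lower_bound section cf_threshold potential_NN potential_NNN penalty st
    limit_NN limit_NNN nondecreasing_NN nondecreasing_NNN us sP _ eps0 adm).
  exact/eqP.
rewrite lte_fin -subr_gt0.
have -> : \sum_(x <- s) \sum_(p | crossing cells x p) (om p - eps) - U =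
    \sum_(x <- s) \sum_(p | crossing cells x p) (om p - b x p) - eps * N.
  rewrite /U /N mulr_sumr -!sumrB; apply: eq_bigr => x _.
  rewrite mulr_sumr -!sumrB; apply: eq_bigr => p _; ring.
have b_le x p : 0 <= om p - b x p.
  rewrite /b; case: ifP => _; last by rewrite subrr.
  by rewrite subr0 (bond_limit_ge0 potential_NN potential_NNN limit_NN limit_NNN).
have gap : om p1 <= \sum_(x <- s) \sum_(p | crossing cells x p) (om p - b x p).
  rewrite (big_rem x1) //= (bigD1 p1) //= {1}/b !eqxx subr0 -addrA lerDl addr_ge0 //.
    exact: sumr_ge0.
  by apply: sumr_ge0 => x _; exact: sumr_ge0.
have epsN : eps * N < om p1.
  rewrite /eps mulrAC ltr_pdivrMr; last by rewrite mulr_gt0 // ltr_wpDl.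
  by rewrite ltr_pM2l //; lra.
lra.
Qed.
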